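(* $(\mathbf{SupLat},\otimes,\mathsf{2})$, where $\otimes$ is the concept tensor of complete lattices, is a symmetric monoidal category with discarding, with $\mathbf{CLat}$ as a symmetric monoidal subcategory. Moreover, the functors $\mathbb{B}\colon\mathbf{Cxt}\to\mathbf{SupLat}$ (concept lattice) and $F\colon\mathbf{SupLat}\to\mathbf{Cxt}$ provide a symmetric monoidal equivalence $(\mathbf{Cxt},\otimes,\mathbb{I})\simeq(\mathbf{SupLat},\otimes,\mathsf{2})$ which preserves discarding.
   Context: **Formal contexts.** A formal context is $\mathbb{K}=(G,M,\models)$ with sets $G,M$ and a relation $\models\ \subseteq G\times M$. For $A\subseteq G$: $A'=\{m\in M\mid a\models m\ \forall a\in A\}$; for $B\subseteq M$: $B'=\{g\in G\mid g\models b\ \forall b\in B\}$. Closure: $\overline{A}=A''$; $A$ is closed if $A=\overline{A}$ (and similarly for subsets of $M$). A concept is a pair $(A,B)$, $A\subseteq G$, $B\subseteq M$, with $A=B'$, $B=A'$; concepts ordered by $(A_1,B_1)\le(A_2,B_2)$ iff $A_1\subseteq A_2$ form a complete lattice $\mathbb{B}(\mathbb{K})$. **Category $\mathbf{Cxt}$.** For a relation $R\colon X\to Y$ write $R(A)=\{y\mid\exists a\in A,\ R(a,y)\}$, $R(x)=R(\{x\})$ and $R^\bullet(Z)=\{x\mid R(x)\subseteq Z\}$. Objects: formal contexts. Morphisms $\mathbb{K}_1\to\mathbb{K}_2$: closed relations $R\colon G_1\to G_2$, i.e. every $R(g)$ is closed and $R^\bullet$ preserves closed sets. Composition $(S\circ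 R)(g)=\overline{S(R(g))}$, identity $g\mapsto\overline{\{g\}}$. **Monoidal structure on $\mathbf{Cxt}$.** $\mathbb{K}_1\otimes\mathbb{K}_2=(G_1\times G_2,M_1\times M_2,\triangledown)$ with $(g_1,g_2)\mathrel{\triangledown}(m_1,m_2)$ iff $g_1\models m_1$ or $g_2\models m_2$; $(R_1\otimes R_2)(g_1,g_2)=\overline{R_1(g_1)\times R_2(g_2)}$; unit $\mathbb{I}=(\{\star\},\{\star\},\neq)$; structure isomorphisms are those of sets and relations followed by closure, e.g. $\alpha(g_1,(g_2,g_3))=\overline{\{((g_1,g_2),g_3)\}}$, $\sigma(g_1,g_2)=\overline{\{(g_2,g_1)\}}$, $\rho(g_1,\star)=\overline{\{g_1\}}$. This is a symmetric monoidal category. **Discarding.** A symmetric monoidal category has discarding if each object $A$ has a chosen morphism $d_A\colon A\to I$ with $d_I=\mathrm{id}_I$ and $d_{A\otimes B}=\lambda\circ(d_A\otimes d_B)$, where $\lambda\colon I\otimes I\to I$ is the unitor. In $\mathbf{Cxt}$, $d_{\mathbb{K}}\colon\mathbb{K}\to\mathbb{I}$ is the closed relation $R\colon G\to\{\star\}$ whose associated relation on attributes $R^*\colon\{\star\}\to M$, $R^*(m)=R^\bullet(\{m\}')'$, satisfies $R^*(\star)=M$; explicitly, $R(g)=\emptyset$ if $\{g\}'=M$ and $R(g)=\{\star\}$ otherwise. In $\mathbf{SupLat}$, $d_V\colon V\to\mathsf{2}$ is given by $d_V(x)=1$ iff $x\neq 0$. **Lattices.** $\mathbf{SupLat}$: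 complete lattices (with $0,1$) and maps preserving arbitrary suprema. $\mathbf{CLat}$: its wide subcategory of maps preserving arbitrary suprema and arbitrary infima. $\mathsf{2}=\{0\le 1\}$. **Concept tensor of lattices.** $V_1\otimes V_2$ is the concept lattice of the context $(V_1\times V_2,V_1\times V_2,\triangledown)$ with $(x,y)\mathrel{\triangledown}(w,z)$ iff $x\le w$ or $y\le z$. For $x\in V_1$, $y\in V_2$, $x\odot y\in V_1\otimes V_2$ is the concept with extent $\{(w,z)\mid (w\le x\text{ and }z\le y)\text{ or }w=0\text{ or }z=0\}$. For sup-preserving $f\colon V_1\to W_1$, $g\colon V_2\to W_2$, $f\otimes g\colon V_1\otimes V_2\to W_1\otimes W_2$ is the unique sup-preserving map with $(f\otimes g)(x\odot y)=f(x)\odot g(y)$ for all $x,y$. **Functors.** $\mathbb{B}$ sends $\mathbb{K}$ to $\mathbb{B}(\mathbb{K})$ and $R\colon\mathbb{K}_1\to\mathbb{K}_2$ to $\mathbb{B}(R)(A,A')=(\overline{R(A)},R(A)')$. $F$ sends $V$ to $F(V)=(V,V,\le)$ and $f\colon V_1\to V_2$ to the closed relation $F(f)(v)=\overline{\{f(v)\}}=\{w\in V_2\mid w\le f(v)\}$. These form an equivalence of categories $\mathbf{Cxt}\simeq\mathbf{SupLat}$, and $\mathbb{B}(\mathbb{I})\cong\mathsf{2}$. *)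

(* Defs.v *)
From mathcomp Require Import all_boot.
From mathcomp Require Import boolp classical_sets.

Set Implicit Arguments.
Unset Strict Implicit.
Unset Printing Implicit Defensive.

Local Open Scope classical_set_scope.

Declare Scope cat_scope.
Local Open Scope cat_scope.

(** * Categories *)

Record category := Category {
  obj :> Type;
  hom : obj -> obj -> Type;
  idm : forall A, hom A A;
  cmp : forall A B C, hom B C -> hom A B -> hom A C;
  cmp1m : forall A B (f : hom A B), cmp (idm B) f = f;
  cmpm1 : forall A B (f : hom A B), cmp f (idm A) = f;
  cmpA : forall A B C D (h : hom C D) (g : hom B C) (f : hom A B),
    cmp h (cmp g f) = cmp (cmp h g) f }.

Arguments hom {c} A B.
Arguments idm {c} A.
Arguments cmp {c A B C} g f.

Notation "g ∘ f" := (cmp g f) (at level 40, left associativity) : cat_scope.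

Definition is_iso (C : category) (A B : C) (f : hom A B) : Prop :=
  exists g : hom B A, g ∘ f = idm A /\ f ∘ g = idm B.

Record functor (C D : category) := Functor {
  fobj :> C -> D;
  fmap : forall A B : C, hom A B -> hom (fobj A) (fobj B);
  fmap1 : forall A : C, fmap (idm A) = idm (fobj A);
  fmapM : forall (X Y Z : C) (g : hom Y Z) (f : hom X Y),
    fmap (g ∘ f) = fmap g ∘ fmap f }.

Arguments fmap {C D} F {A B} f : rename.

Definition functor_id (C : category) : functor C C :=
  @Functor C C id (fun A B f => f) (fun A => erefl) (fun X Y Z g f => erefl).

Lemma functor_comp_subproof1 (C D E : category) (G : functor D E)
    (F : functor C D) (A : C) :
  fmap G (fmap F (idm A)) = idm (G (F A)).
Proof. by rewrite !fmap1. Qed.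

Lemma functor_comp_subproofM (C D E : category) (G : functor D E)
    (F : functor C D) (X Y Z : C) (g : hom Y Z) (f : hom X Y) :
  fmap G (fmap F (g ∘ f)) = fmap G (fmap F g) ∘ fmap G (fmap F f).
Proof. by rewrite !fmapM. Qed.

Definition functor_comp (C D E : category) (G : functor D E)
    (F : functor C D) : functor C E :=
  @Functor C E (fun A => G (F A)) (fun A B f => fmap G (fmap F f))
    (@functor_comp_subproof1 C D E G F) (@functor_comp_subproofM C D E G F).

Definition is_nat_iso (C D : category) (F G : functor C D)
    (t : forall A, hom (F A) (G A)) : Prop :=
  (forall A, is_iso (t A)) /\
  (forall (A B : C) (f : hom A B), t B ∘ fmap F f = fmap G f ∘ t A).

(** * Symmetric monoidal categories *)

(* The object part of the tensor and the unit are parameters, so that one can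
   speak of the symmetric monoidal structures on a given pair (⊗, I). *)
Record sym_monoidal (C : category) (tens : C -> C -> C) (I : C) := SymMonoidal {
  tensm : forall A1 B1 A2 B2 : C,
    hom A1 B1 -> hom A2 B2 -> hom (tens A1 A2) (tens B1 B2);
  assoc : forall X Y Z : C, hom (tens X (tens Y Z)) (tens (tens X Y) Z);
  lunit : forall X : C, hom (tens I X) X;
  runit : forall X : C, hom (tens X I) X;
  braid : forall X Y : C, hom (tens X Y) (tens Y X);
  tensm1 : forall X Y : C, tensm (idm X) (idm Y) = idm (tens X Y);
  tensmM : forall (X1 Y1 Z1 X2 Y2 Z2 : C) (g1 : hom Y1 Z1) (f1 : hom X1 Y1)
      (g2 : hom Y2 Z2) (f2 : hom X2 Y2),
    tensm (g1 ∘ f1) (g2 ∘ f2) = tensm g1 g2 ∘ tensm f1 f2;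
  assoc_iso : forall X Y Z : C, is_iso (assoc X Y Z);
  assoc_nat : forall (X Y Z X' Y' Z' : C)
      (f : hom X X') (g : hom Y Y') (h : hom Z Z'),
    assoc X' Y' Z' ∘ tensm f (tensm g h) =
    tensm (tensm f g) h ∘ assoc X Y Z;
  lunit_iso : forall X : C, is_iso (lunit X);
  lunit_nat : forall (X Y : C) (f : hom X Y),
    lunit Y ∘ tensm (idm I) f = f ∘ lunit X;
  runit_iso : forall X : C, is_iso (runit X);
  runit_nat : forall (X Y : C) (f : hom X Y),
    runit Y ∘ tensm f (idm I) = f ∘ runit X;
  braid_nat : forall (X Y X' Y' : C) (f : hom X X') (g : hom Y Y'),
    braid X' Y' ∘ tensm f g = tensm g f ∘ braid X Y;
  pentagon : forall W X Y Z : C,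
    assoc (tens W X) Y Z ∘ assoc W X (tens Y Z) =
    tensm (assoc W X Y) (idm Z) ∘ assoc W (tens X Y) Z
      ∘ tensm (idm W) (assoc X Y Z);
  triangle : forall X Y : C,
    tensm (runit X) (idm Y) ∘ assoc X I Y = tensm (idm X) (lunit Y);
  hexagon : forall X Y Z : C,
    assoc Z X Y ∘ braid (tens X Y) Z ∘ assoc X Y Z =
    tensm (braid X Z) (idm Y) ∘ assoc X Z Y ∘ tensm (idm X) (braid Y Z);
  braidK : forall X Y : C, braid Y X ∘ braid X Y = idm (tens X Y) }.

Arguments tensm {C tens I} S {A1 B1 A2 B2} f g : rename.
Arguments assoc {C tens I} S X Y Z : rename.
Arguments lunit {C tens I} S X : rename.
Arguments runit {C tens I} S X : rename.
Arguments braid {C tens I} S X Y : rename.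

Record discarding (C : category) (tens : C -> C -> C) (I : C)
    (S : sym_monoidal tens I) := Discarding {
  disc :> forall A : C, hom A I;
  disc_unit : disc I = idm I;
  disc_tens : forall A B : C,
    disc (tens A B) = lunit S I ∘ tensm S (disc A) (disc B) }.

(* A wide subcategory is given by its morphisms.  The inverses of the structure
   isomorphisms are required to be in it too, so that these are isomorphisms of
   the subcategory. *)
Definition iso_within (C : category)
    (P : forall A B : C, hom A B -> Prop) (A B : C) (f : hom A B) : Prop :=
  P A B f /\
  exists g : hom B A, [/\ P B A g, g ∘ f = idm A & f ∘ g = idm B].

Record sym_monoidal_wide_subcategory (C : category) (tens : C -> C -> C) (I : C)
    (S : sym_monoidal tens I) (P : forall A B : C, hom A B -> Prop) : Prop :=
  SymMonoidalWideSubcategory {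
  wsub_id : forall A : C, P A A (idm A);
  wsub_cmp : forall (X Y Z : C) (g : hom Y Z) (f : hom X Y),
    P Y Z g -> P X Y f -> P X Z (g ∘ f);
  wsub_tens : forall (A1 B1 A2 B2 : C) (f : hom A1 B1) (g : hom A2 B2),
    P A1 B1 f -> P A2 B2 g -> P (tens A1 A2) (tens B1 B2) (tensm S f g);
  wsub_assoc : forall X Y Z : C, iso_within P (assoc S X Y Z);
  wsub_lunit : forall X : C, iso_within P (lunit S X);
  wsub_runit : forall X : C, iso_within P (runit S X);
  wsub_braid : forall X Y : C, iso_within P (braid S X Y) }.

(** * Symmetric monoidal functors and equivalences *)

Section MonoidalFunctors.
Variables (C : category) (tC : C -> C -> C) (IC : C).
Variables (D : category) (tD : D -> D -> D) (ID : D).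

Record mon_data (F : functor C D) := MonData {
  mu : forall A B : C, hom (tD (F A) (F B)) (F (tC A B));
  nu : hom ID (F IC) }.

Variables (SC : sym_monoidal tC IC) (SD : sym_monoidal tD ID).

Record is_sym_monoidal_functor (F : functor C D) (M : mon_data F) : Prop :=
  IsSymMonoidalFunctor {
  mu_iso : forall A B : C, is_iso (mu M A B);
  mu_nat : forall (A1 B1 A2 B2 : C) (f : hom A1 B1) (g : hom A2 B2),
    mu M B1 B2 ∘ tensm SD (fmap F f) (fmap F g) =
    fmap F (tensm SC f g) ∘ mu M A1 A2;
  nu_iso : is_iso (nu M);
  mu_assoc : forall X Y Z : C,
    fmap F (assoc SC X Y Z) ∘ mu M X (tC Y Z)
      ∘ tensm SD (idm (F X)) (mu M Y Z) =
    mu M (tC X Y) Z ∘ tensm SD (mu M X Y) (idm (F Z))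
      ∘ assoc SD (F X) (F Y) (F Z);
  mu_lunit : forall X : C,
    fmap F (lunit SC X) ∘ mu M IC X ∘ tensm SD (nu M) (idm (F X)) =
    lunit SD (F X);
  mu_runit : forall X : C,
    fmap F (runit SC X) ∘ mu M X IC ∘ tensm SD (idm (F X)) (nu M) =
    runit SD (F X);
  mu_braid : forall X Y : C,
    fmap F (braid SC X Y) ∘ mu M X Y = mu M Y X ∘ braid SD (F X) (F Y) }.

Definition preserves_discarding (F : functor C D) (M : mon_data F)
    (dC : discarding SC) (dD : discarding SD) : Prop :=
  forall A : C, fmap F (dC A) = nu M ∘ dD (F A).

Definition is_monoidal_nat_iso (F G : functor C D)
    (M : mon_data F) (N : mon_data G) (t : forall A, hom (F A) (G A)) : Prop :=
  [/\ is_nat_iso t,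
      forall A B : C, t (tC A B) ∘ mu M A B = mu N A B ∘ tensm SD (t A) (t B) &
      t IC ∘ nu M = nu N].

End MonoidalFunctors.

Definition mon_data_id (C : category) (tC : C -> C -> C) (IC : C) :
    mon_data tC IC tC IC (functor_id C) :=
  @MonData C tC IC C tC IC (functor_id C) (fun A B => idm (tC A B)) (idm IC).

Definition mon_data_comp (C D E : category)
    (tC : C -> C -> C) (IC : C) (tD : D -> D -> D) (ID : D)
    (tE : E -> E -> E) (IE : E) (G : functor D E) (F : functor C D)
    (N : mon_data tD ID tE IE G) (M : mon_data tC IC tD ID F) :
    mon_data tC IC tE IE (functor_comp G F) :=
  @MonData C tC IC E tE IE (functor_comp G F)
    (fun A B => fmap G (mu M A B) ∘ mu N (F A) (F B))
    (fmap G (nu M) ∘ nu N).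

Definition is_sym_monoidal_equivalence (C D : category)
    (tC : C -> C -> C) (IC : C) (tD : D -> D -> D) (ID : D)
    (SC : sym_monoidal tC IC) (SD : sym_monoidal tD ID)
    (F : functor C D) (G : functor D C)
    (MF : mon_data tC IC tD ID F) (MG : mon_data tD ID tC IC G) : Prop :=
  [/\ is_sym_monoidal_functor SC SD MF,
      is_sym_monoidal_functor SD SC MG,
      exists eta : forall A : C, hom A (G (F A)),
        is_monoidal_nat_iso (F := functor_id C) (G := functor_comp G F)
          SC (mon_data_id tC IC) (mon_data_comp MG MF) eta &
      exists eps : forall A : D, hom (F (G A)) A,
        is_monoidal_nat_iso (F := functor_comp F G) (G := functor_id D)
          SD (mon_data_comp MF MG) (mon_data_id tD ID) eps].

(** * Formal contexts *)

Record context := Context {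
  gob : Type;
  att : Type;
  inc : gob -> att -> Prop }.

Section Derivation.
Variable K : context.
Implicit Types (A Z : set (gob K)) (B : set (att K)).

Definition up A : set (att K) := [set m | forall a, A a -> inc a m].
Definition dn B : set (gob K) := [set g | forall b, B b -> inc g b].
Definition closure A : set (gob K) := dn (up A).
Definition closed A : Prop := closure A = A.

Lemma sub_closure A : A `<=` closure A.
Proof. by move=> a Aa m; apply. Qed.

Lemma closureS A Z : A `<=` Z -> closure A `<=` closure Z.
Proof. by move=> AZ g gA m Zm; apply: gA => a /AZ; exact: Zm. Qed.

Lemma closed_dn B : closed (dn B).
Proof.
by apply/seteqP; split; [move=> g gB b Bb; apply: gB => a; apply |
                         exact: sub_closure].
Qed.

Lemma closed_closure A : closed (closure A).
Proof. exact: closed_dn. Qed.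

Lemma up_closure A : up (closure A) = up A.
Proof.
apply/seteqP; split=> m; first by move=> h a /sub_closure; exact: h.
by move=> Am g; apply.
Qed.

Lemma closure_sub A Z : closed Z -> (closure A `<=` Z) <-> (A `<=` Z).
Proof.
move=> cZ; split; first by apply: subset_trans; exact: sub_closure.
by move=> AZ; rewrite -cZ; exact: closureS.
Qed.

Lemma closed_eq A Z : closed A -> closed Z ->
  (forall W, closed W -> (A `<=` W) <-> (Z `<=` W)) -> A = Z.
Proof. by move=> cA cZ h; apply/seteqP; split; [apply/h|apply/h]. Qed.

Lemma eq_closed A Z : A `<=>` Z -> closed A -> closed Z.
Proof. by move=> /seteqP ->. Qed.

Lemma closed_sep Z :
  (forall x, ~ Z x -> exists W, [/\ closed W, Z `<=` W & ~ W x]) -> closed Z.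
Proof.
move=> h; apply/seteqP; split; last exact: sub_closure.
move=> x xZ; apply: contrapT => /h[W [cW ZW]]; apply.
exact: (iffRL (closure_sub _ cW) ZW).
Qed.

End Derivation.

Arguments up {K} A.
Arguments dn {K} B.
Arguments closure {K} A.
Arguments closed {K} A.

(** * The category of contexts and closed relations *)

Definition rimage X Y (R : X -> set Y) (A : set X) : set Y :=
  [set y | exists2 a, A a & R a y].
Definition bullet X Y (R : X -> set Y) (Z : set Y) : set X :=
  [set x | R x `<=` Z].

Record closed_rel (K1 K2 : context) := ClosedRel {
  rel_of :> gob K1 -> set (gob K2);
  rel_closed : forall g, closed (rel_of g);
  rel_bullet : forall Z, closed Z -> closed (bullet rel_of Z) }.

Lemma closed_relP K1 K2 (R S : closed_rel K1 K2) :
  (forall g Z, closed Z -> (R g `<=` Z) <-> (S g `<=` Z)) -> R = S.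
Proof.
case: R S => [R cR bR] [S cS bS] /= h.
have RS : R = S by apply: funext => g; apply: closed_eq (cR g) (cS g) (h g).
by subst S; rewrite (Prop_irrelevance cR cS) (Prop_irrelevance bR bS).
Qed.

Lemma rimage_sub X Y (R : X -> set Y) A Z :
  (rimage R A `<=` Z) <-> (A `<=` bullet R Z).
Proof.
split=> [h a Aa y Ray|h y [a Aa]]; first by apply: h; exists a.
exact: h.
Qed.

Section Cmp.
Variables (K1 K2 K3 : context) (S : closed_rel K2 K3) (R : closed_rel K1 K2).

Definition crel_cmp_fun (g : gob K1) : set (gob K3) := closure (rimage S (R g)).

Lemma crel_cmp_sub g Z : closed Z ->
  (crel_cmp_fun g `<=` Z) <-> (R g `<=` bullet S Z).
Proof. by move=> cZ; rewrite closure_sub // rimage_sub. Qed.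

Lemma crel_cmp_subproof Z : closed Z -> closed (bullet crel_cmp_fun Z).
Proof.
move=> cZ; suff -> : bullet crel_cmp_fun Z = bullet R (bullet S Z).
  by apply: rel_bullet; apply: rel_bullet.
by apply/seteqP; split=> g /crel_cmp_sub; apply.
Qed.

Definition crel_cmp : closed_rel K1 K3 :=
  ClosedRel (fun g => closed_closure _) crel_cmp_subproof.

End Cmp.

(* The closed relation g |-> closure {phi g} induced by a function phi whose
   preimages of closed sets are closed. *)
Section PureRel.
Variables (K1 K2 : context) (phi : gob K1 -> gob K2).
Hypothesis phi_closed : forall Z, closed Z -> closed (phi @^-1` Z).

Lemma pure_sub g Z : closed Z -> (closure [set phi g] `<=` Z) <-> Z (phi g).
Proof.
by move=> cZ; rewrite closure_sub //; split=> [h|h _ ->//]; exact: h.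
Qed.

Lemma pure_rel_subproof Z : closed Z ->
  closed (bullet (fun g => closure [set phi g]) Z).
Proof.
move=> cZ; suff -> : bullet (fun g => closure [set phi g]) Z = phi @^-1` Z.
  exact: phi_closed.
by apply/seteqP; split=> g /(pure_sub g cZ).
Qed.

Definition pure_rel : closed_rel K1 K2 :=
  ClosedRel (fun g => closed_closure [set phi g]) pure_rel_subproof.

End PureRel.

(* Closed relations are compared through R |-> bullet R, which turns composites,
   tensors and induced relations into elementary formulas. *)
Lemma bullet_cmp K1 K2 K3 (S : closed_rel K2 K3) (R : closed_rel K1 K2) Z :
  closed Z -> bullet (crel_cmp S R) Z = bullet R (bullet S Z).
Proof. by move=> cZ; apply/seteqP; split=> g /crel_cmp_sub; apply. Qed.

Lemma bullet_pure K1 K2 (phi : gob K1 -> gob K2) h Z :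
  closed Z -> bullet (@pure_rel K1 K2 phi h) Z = phi @^-1` Z.
Proof. by move=> cZ; apply/seteqP; split=> g /(pure_sub phi g cZ). Qed.

Lemma eq_crel K1 K2 (R S : closed_rel K1 K2) :
  (forall Z, closed Z -> bullet R Z = bullet S Z) -> R = S.
Proof.
move=> h; apply: closed_relP => g Z cZ.
by have /(congr1 (fun A => A g)) := h Z cZ; rewrite /bullet /mkset => ->.
Qed.

Lemma crel_id_subproof (K : context) (Z : set (gob K)) :
  closed Z -> closed (id @^-1` Z).
Proof. by []. Qed.

Definition crel_id K : closed_rel K K := pure_rel (@crel_id_subproof K).

Lemma crel_cmp1m K1 K2 (R : closed_rel K1 K2) : crel_cmp (crel_id K2) R = R.
Proof. by apply: eq_crel => Z cZ; rewrite bullet_cmp // bullet_pure. Qed.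

Lemma crel_cmpm1 K1 K2 (R : closed_rel K1 K2) : crel_cmp R (crel_id K1) = R.
Proof.
apply: eq_crel => Z cZ; rewrite bullet_cmp // bullet_pure //.
exact: rel_bullet.
Qed.

Lemma crel_cmpA K1 K2 K3 K4 (T : closed_rel K3 K4) (S : closed_rel K2 K3)
    (R : closed_rel K1 K2) :
  crel_cmp T (crel_cmp S R) = crel_cmp (crel_cmp T S) R.
Proof.
apply: eq_crel => Z cZ; have cT := rel_bullet T cZ.
by rewrite !bullet_cmp.
Qed.

Definition Cxt : category :=
  @Category context closed_rel crel_id crel_cmp crel_cmp1m crel_cmpm1 crel_cmpA.

(** * The symmetric monoidal structure on contexts *)

Definition cxt_tens (K1 K2 : context) : context :=
  @Context (gob K1 * gob K2) (att K1 * att K2)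
    (fun g m => inc g.1 m.1 \/ inc g.2 m.2).

Definition cxt_unit : context := @Context unit unit (fun x y => x <> y).

Lemma closed_cxt_unit (Z : set (gob cxt_unit)) : closed Z.
Proof.
apply: closed_sep => -[] nZ; exists Z; split=> //.
apply/seteqP; split; last exact: sub_closure.
case=> /(_ tt) h; exfalso; apply: h => //.
by case=> Zt; case: nZ.
Qed.

Lemma closed_tens_gen K1 K2 (Z1 : set (gob K1)) (Z2 : set (gob K2)) :
  closed Z1 -> closed Z2 ->
  closed ([set p | Z1 p.1 \/ Z2 p.2] : set (gob (cxt_tens K1 K2))).
Proof.
move=> c1 c2.
suff -> : [set p | Z1 p.1 \/ Z2 p.2] =
    dn ([set m | up Z1 m.1 /\ up Z2 m.2] : set (att (cxt_tens K1 K2))).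
  exact: closed_dn.
apply/seteqP; split=> -[x y] /=.
  by move=> [Zx|Zy] [m n] /= [um un]; [left; apply: um|right; apply: un].
move=> h; apply: contrapT => /not_orP[].
rewrite -{1}c1 -{1}c2 => /existsNP[m /not_implyP[um nm]].
by move=> /existsNP[n /not_implyP[un nn]]; case: (h (m, n)).
Qed.

(* A closed set of the tensor is an intersection of sets as above. *)
Lemma closed_tens_ind K1 K2 (P : set (gob (cxt_tens K1 K2)) -> Prop) :
  (forall B : set (att (cxt_tens K1 K2)),
     P (fun p => forall m, B m -> dn [set m.1] p.1 \/ dn [set m.2] p.2)) ->
  forall Z, closed Z -> P Z.
Proof.
move=> h Z <-; suff -> : closure Z = (fun p => forall m, up Z m ->
    dn [set m.1] p.1 \/ dn [set m.2] p.2) by apply: h.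
apply/seteqP; split=> p zp m um; case: (zp m um) => q.
- by left=> _ ->.
- by right=> _ ->.
- by left; apply: q.
- by right; apply: q.
Qed.

Lemma closed_inter K (I : Type) (P : I -> Prop) (Z : I -> set (gob K)) :
  (forall i, P i -> closed (Z i)) ->
  closed ([set g | forall i, P i -> Z i g] : set (gob K)).
Proof.
move=> cZ; apply: closed_sep => x /existsNP[i /not_implyP[Pi nZ]].
by exists (Z i); split=> //; [exact: cZ|move=> y; apply].
Qed.

Lemma closed_secl K1 K2 (Z : set (gob (cxt_tens K1 K2))) g2 :
  closed Z -> closed ([set g1 | Z (g1, g2)] : set (gob K1)).
Proof.
apply: (closed_tens_ind (P := fun Z =>
  closed ([set g1 | Z (g1, g2)] : set (gob K1)))) => B.
apply: closed_inter => -[m n] _ /=; have [h|h] := pselect (dn [set n] g2).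
  by apply: (@eq_closed _ (dn set0)); [split=> [x _|x _ b []//]; right|exact: closed_dn].
by apply: (@eq_closed _ (dn [set m])); [split=> x; [left|case]|exact: closed_dn].
Qed.

Lemma closed_secr K1 K2 (Z : set (gob (cxt_tens K1 K2))) g1 :
  closed Z -> closed ([set g2 | Z (g1, g2)] : set (gob K2)).
Proof.
apply: (closed_tens_ind (P := fun Z =>
  closed ([set g2 | Z (g1, g2)] : set (gob K2)))) => B.
apply: closed_inter => -[m n] _ /=; have [h|h] := pselect (dn [set m] g1).
  by apply: (@eq_closed _ (dn set0)); [split=> [x _|x _ b []//]; left|exact: closed_dn].
by apply: (@eq_closed _ (dn [set n])); [split=> x; [right|case]|exact: closed_dn].
Qed.

Section TensRel.
Variables (K1 L1 K2 L2 : context).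
Variables (R1 : closed_rel K1 L1) (R2 : closed_rel K2 L2).

Definition crel_tens_fun (g : gob (cxt_tens K1 K2)) :
    set (gob (cxt_tens L1 L2)) :=
  closure (R1 g.1 `*` R2 g.2 : set (gob (cxt_tens L1 L2))).

Lemma crel_tens_sub g Z : closed Z -> (crel_tens_fun g `<=` Z) <->
  (R1 g.1 `<=` [set h1 | R2 g.2 `<=` [set h2 | Z (h1, h2)]]).
Proof.
move=> cZ; rewrite closure_sub //; split=> [h h1 ? h2 ?|h [h1 h2] [/= r1 r2]].
  exact: h.
exact: h r1 _ r2.
Qed.

Lemma crel_tens_subproof Z : closed Z -> closed (bullet crel_tens_fun Z).
Proof.
move=> cZ; suff -> : bullet crel_tens_fun Z = [set g | forall m,
    up Z m -> bullet R1 (dn [set m.1]) g.1 \/ bullet R2 (dn [set m.2]) g.2].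
  apply: closed_inter => m _.
  by apply: closed_tens_gen; apply: rel_bullet; exact: closed_dn.
apply/seteqP; split=> g.
  move=> /(crel_tens_sub _ cZ) h m um; apply: contrapT => /not_orP[].
  move=> /existsNP[h1 /not_implyP[r1 n1]] /existsNP[h2 /not_implyP[r2 n2]].
  by case: (um _ (h _ r1 _ r2)) => i; [apply: n1|apply: n2] => _ ->.
move=> h; apply/(crel_tens_sub _ cZ) => h1 r1 h2 r2 /=.
rewrite -cZ => m /h[]; first by move=> /(_ _ r1 m.1 erefl); left.
by move=> /(_ _ r2 m.2 erefl); right.
Qed.

Definition crel_tens : closed_rel (cxt_tens K1 K2) (cxt_tens L1 L2) :=
  ClosedRel (fun g => closed_closure _) crel_tens_subproof.

End TensRel.

Lemma cxt_assoc_subproof K1 K2 K3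
    (Z : set (gob (cxt_tens (cxt_tens K1 K2) K3))) : closed Z ->
  closed ((fun g => ((g.1, g.2.1), g.2.2)) @^-1` Z :
            set (gob (cxt_tens K1 (cxt_tens K2 K3)))).
Proof.
move=> cZ; suff -> : (fun g => ((g.1, g.2.1), g.2.2)) @^-1` Z =
    dn ([set m | up Z ((m.1, m.2.1), m.2.2)] :
            set (att (cxt_tens K1 (cxt_tens K2 K3)))) by exact: closed_dn.
rewrite -{1}cZ; apply/seteqP; split=> -[x [y z]] h.
  by move=> [m [n p]] /= /h /= [[]|]; tauto.
by move=> [[m n] p] hm; case: (h (m, (n, p)) hm) => [|[]] /=; tauto.
Qed.

Lemma cxt_assoc_inv_subproof K1 K2 K3
    (Z : set (gob (cxt_tens K1 (cxt_tens K2 K3)))) : closed Z ->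
  closed ((fun g => (g.1.1, (g.1.2, g.2))) @^-1` Z :
            set (gob (cxt_tens (cxt_tens K1 K2) K3))).
Proof.
move=> cZ; suff -> : (fun g => (g.1.1, (g.1.2, g.2))) @^-1` Z =
    dn ([set m | up Z (m.1.1, (m.1.2, m.2))] :
            set (att (cxt_tens (cxt_tens K1 K2) K3))) by exact: closed_dn.
rewrite -{1}cZ; apply/seteqP; split=> -[[x y] z] h.
  by move=> [[m n] p] /= /h /= [|[]]; tauto.
by move=> [m [n p]] hm; case: (h ((m, n), p) hm) => [[]|] /=; tauto.
Qed.

Lemma cxt_lunit_subproof K (Z : set (gob K)) : closed Z ->
  closed (snd @^-1` Z : set (gob (cxt_tens cxt_unit K))).
Proof.
move=> cZ.
rewrite (_ : _ @^-1` _ = [set p | (set0 : set (gob cxt_unit)) p.1 \/ Z p.2]).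
  by apply: closed_tens_gen => //; exact: closed_cxt_unit.
by apply/seteqP; split=> p; [right|case].
Qed.

Lemma cxt_lunit_inv_subproof K (Z : set (gob (cxt_tens cxt_unit K))) :
  closed Z -> closed ((fun g => (tt, g)) @^-1` Z : set (gob K)).
Proof. exact: closed_secr. Qed.

Lemma cxt_runit_subproof K (Z : set (gob K)) : closed Z ->
  closed (fst @^-1` Z : set (gob (cxt_tens K cxt_unit))).
Proof.
move=> cZ.
rewrite (_ : _ @^-1` _ = [set p | Z p.1 \/ (set0 : set (gob cxt_unit)) p.2]).
  by apply: closed_tens_gen => //; exact: closed_cxt_unit.
by apply/seteqP; split=> p; [left|case].
Qed.

Lemma cxt_runit_inv_subproof K (Z : set (gob (cxt_tens K cxt_unit))) :
  closed Z -> closed ((fun g => (g, tt)) @^-1` Z : set (gob K)).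
Proof. exact: closed_secl. Qed.

Lemma cxt_braid_subproof K1 K2 (Z : set (gob (cxt_tens K2 K1))) :
  closed Z ->
  closed ((fun g => (g.2, g.1)) @^-1` Z : set (gob (cxt_tens K1 K2))).
Proof.
move=> cZ; suff -> : (fun g => (g.2, g.1)) @^-1` Z =
    dn ([set m | up Z (m.2, m.1)] : set (att (cxt_tens K1 K2))).
  exact: closed_dn.
rewrite -{1}cZ; apply/seteqP; split=> -[x y] h.
  by move=> [m n] /= /h /=; tauto.
by move=> [m n] hm; case: (h (n, m) hm) => /=; tauto.
Qed.

Definition cxt_assoc K1 K2 K3 :
    closed_rel (cxt_tens K1 (cxt_tens K2 K3)) (cxt_tens (cxt_tens K1 K2) K3) :=
  pure_rel (@cxt_assoc_subproof K1 K2 K3).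
Definition cxt_lunit K : closed_rel (cxt_tens cxt_unit K) K :=
  pure_rel (@cxt_lunit_subproof K).
Definition cxt_runit K : closed_rel (cxt_tens K cxt_unit) K :=
  pure_rel (@cxt_runit_subproof K).
Definition cxt_braid K1 K2 : closed_rel (cxt_tens K1 K2) (cxt_tens K2 K1) :=
  pure_rel (@cxt_braid_subproof K1 K2).

Lemma bullet_tens K1 L1 K2 L2 (R1 : closed_rel K1 L1) (R2 : closed_rel K2 L2) Z :
  closed Z -> bullet (crel_tens R1 R2) Z =
  [set g | bullet R1 [set h1 | bullet R2 [set h2 | Z (h1, h2)] g.2] g.1].
Proof. by move=> cZ; apply/seteqP; split=> g /crel_tens_sub; apply. Qed.

Lemma bullet_tensC K1 L1 K2 L2 (R1 : closed_rel K1 L1) (R2 : closed_rel K2 L2) Z :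
  closed Z -> bullet (crel_tens R1 R2) Z =
  [set g | bullet R2 [set h2 | bullet R1 [set h1 | Z (h1, h2)] g.1] g.2].
Proof.
move=> cZ; rewrite bullet_tens //.
by apply/seteqP; split=> g h x rx y ry; apply: h.
Qed.

Definition is_pure K1 K2 (R : closed_rel K1 K2) (phi : gob K1 -> gob K2) : Prop :=
  forall Z, closed Z -> bullet R Z = phi @^-1` Z.

Lemma is_pure_pure K1 K2 phi h : is_pure (@pure_rel K1 K2 phi h) phi.
Proof. by move=> Z; exact: bullet_pure. Qed.

Lemma is_pure_eq K1 K2 (R S : closed_rel K1 K2) phi psi :
  is_pure R phi -> is_pure S psi -> phi =1 psi -> R = S.
Proof.
by move=> hR hS /funext e; apply: eq_crel => Z cZ; rewrite hR // hS // e.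
Qed.

Lemma is_pure_cmp K1 K2 K3 (S : closed_rel K2 K3) (R : closed_rel K1 K2)
    phi psi : is_pure R phi -> is_pure S psi ->
  is_pure (crel_cmp S R) (psi \o phi).
Proof.
move=> hR hS Z cZ; rewrite bullet_cmp // hR ?hS //.
by rewrite -hS //; exact: rel_bullet.
Qed.

Lemma is_pure_tens K1 L1 K2 L2 (R : closed_rel K1 L1) (S : closed_rel K2 L2)
    phi psi : is_pure R phi -> is_pure S psi ->
  is_pure (crel_tens R S) (fun g => (phi g.1, psi g.2)).
Proof.
move=> hR hS Z cZ; rewrite bullet_tens //.
have e y : [set h1 | bullet S [set h2 | Z (h1, h2)] y] = [set h1 | Z (h1, psi y)].
  by apply/seteqP; split=> z /=; rewrite hS //; exact: closed_secr.
by apply/seteqP; split=> -[x y] /=; rewrite e hR //; exact: closed_secl.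
Qed.

Lemma is_iso_pure K1 K2 (phi : gob K1 -> gob K2) (psi : gob K2 -> gob K1)
    hphi (hpsi : forall Z, closed Z -> closed (psi @^-1` Z)) :
  cancel phi psi -> cancel psi phi ->
  is_iso (@pure_rel K1 K2 phi hphi : @hom Cxt K1 K2).
Proof.
move=> e1 e2; exists (pure_rel hpsi); split.
  by apply: (is_pure_eq (is_pure_cmp (is_pure_pure hphi) (is_pure_pure hpsi)));
    [exact: is_pure_pure|exact: e1].
by apply: (is_pure_eq (is_pure_cmp (is_pure_pure hpsi) (is_pure_pure hphi)));
  [exact: is_pure_pure|exact: e2].
Qed.

Ltac pure :=
  repeat first [exact: is_pure_pure | apply: is_pure_cmp | apply: is_pure_tens].

Lemma cxt_tensm1 K1 K2 :
  crel_tens (crel_id K1) (crel_id K2) = crel_id (cxt_tens K1 K2).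
Proof. by apply: is_pure_eq; [pure|pure|case]. Qed.

Lemma cxt_tensmM K1 L1 M1 K2 L2 M2 (S1 : closed_rel L1 M1)
    (R1 : closed_rel K1 L1) (S2 : closed_rel L2 M2) (R2 : closed_rel K2 L2) :
  crel_tens (crel_cmp S1 R1) (crel_cmp S2 R2) =
  crel_cmp (crel_tens S1 S2) (crel_tens R1 R2).
Proof.
apply: eq_crel => Z cZ; have cT := rel_bullet (crel_tens S1 S2) cZ.
rewrite bullet_cmp // (bullet_tens R1 R2 cT) bullet_tens //.
apply/seteqP; split=> -[x y] /= h.
  move=> k1 r1 k2 r2; rewrite /= bullet_tens // => h1 s1 h2 s2 /=.
  apply: (h h1); first by apply: sub_closure; exists k1.
  by apply: sub_closure; exists k2.
suff : bullet (crel_tens (crel_cmp S1 R1) (crel_cmp S2 R2)) Z (x, y).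
  by rewrite bullet_tens.
rewrite bullet_tensC //=.
move=> h2 c2 h1 /=; move: h1; apply/crel_cmp_sub; first exact: closed_secl.
move=> k1 r1 h1 s1 /=; move: h2 c2; apply/crel_cmp_sub.
  exact: closed_secr.
move=> k2 r2 h2 s2 /=; have := h _ r1 _ r2; rewrite /= bullet_tens //.
by apply.
Qed.

Lemma cxt_assoc_nat (X Y Z X' Y' Z' : context)
    (f : closed_rel X X') (g : closed_rel Y Y') (h : closed_rel Z Z') :
  crel_cmp (cxt_assoc X' Y' Z') (crel_tens f (crel_tens g h)) =
  crel_cmp (crel_tens (crel_tens f g) h) (cxt_assoc X Y Z).
Proof.
apply: eq_crel => W cW; have cT := rel_bullet (crel_tens (crel_tens f g) h) cW.
rewrite !bullet_cmp // !bullet_pure //.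
have cA := cxt_assoc_subproof cW; rewrite (bullet_tens _ _ cA).
rewrite (bullet_tensC (crel_tens f g)) //; apply/seteqP; split.
  move=> -[x [y z]] /= e z' hz; rewrite /= bullet_tens //; last exact: closed_secl.
  move=> x' fx y' gy /=; have /= := e x' fx.
  by rewrite (bullet_tens g h) /=; [apply|exact: (closed_secr _ cA)].
move=> -[x [y z]] /= e x' fx /=; rewrite (bullet_tens g h) /=; last first.
  exact: (closed_secr _ cA).
move=> y' gy z' hz /=; have /= := e z' hz.
by rewrite bullet_tens //=; [apply|exact: closed_secl].
Qed.

Lemma cxt_lunit_nat (X Y : context) (f : closed_rel X Y) :
  crel_cmp (cxt_lunit Y) (crel_tens (crel_id cxt_unit) f) =
  crel_cmp f (cxt_lunit X).
Proof.
apply: eq_crel => W cW; have cf := rel_bullet f cW.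
rewrite !bullet_cmp // !bullet_pure //.
rewrite bullet_tens; last exact: cxt_lunit_subproof.
apply/seteqP; split=> -[[] y] /=; last by move=> h x _ z /h.
by move=> h z fz; apply: (h tt) fz; exact: sub_closure.
Qed.

Lemma cxt_runit_nat (X Y : context) (f : closed_rel X Y) :
  crel_cmp (cxt_runit Y) (crel_tens f (crel_id cxt_unit)) =
  crel_cmp f (cxt_runit X).
Proof.
apply: eq_crel => W cW; have cf := rel_bullet f cW.
rewrite !bullet_cmp // !bullet_pure //.
rewrite bullet_tensC; last exact: cxt_runit_subproof.
apply/seteqP; split=> -[y []] /=; last by move=> h x _ z /h.
by move=> h z fz; apply: (h tt) fz; exact: sub_closure.
Qed.

Lemma cxt_braid_nat (X Y X' Y' : context)
    (f : closed_rel X X') (g : closed_rel Y Y') :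
  crel_cmp (cxt_braid X' Y') (crel_tens f g) =
  crel_cmp (crel_tens g f) (cxt_braid X Y).
Proof.
apply: eq_crel => W cW; have cf := rel_bullet (crel_tens g f) cW.
rewrite !bullet_cmp // !bullet_pure // (bullet_tensC g) // bullet_tens //.
exact: cxt_braid_subproof.
Qed.

Lemma cxt_assoc_iso (X Y Z : Cxt) : is_iso (cxt_assoc X Y Z : hom (c := Cxt) _ _).
Proof.
by apply: is_iso_pure (@cxt_assoc_inv_subproof X Y Z) _ _;
  [move=> [x [y z]]|move=> [[x y] z]].
Qed.

Lemma cxt_lunit_iso (X : Cxt) : is_iso (cxt_lunit X : hom (c := Cxt) _ _).
Proof.
by apply: is_iso_pure (@cxt_lunit_inv_subproof X) _ _; [move=> [[] x]|move=> x].
Qed.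

Lemma cxt_runit_iso (X : Cxt) : is_iso (cxt_runit X : hom (c := Cxt) _ _).
Proof.
by apply: is_iso_pure (@cxt_runit_inv_subproof X) _ _; [move=> [x []]|move=> x].
Qed.

Lemma cxt_pentagon (W X Y Z : context) :
  crel_cmp (cxt_assoc (cxt_tens W X) Y Z) (cxt_assoc W X (cxt_tens Y Z)) =
  crel_cmp (crel_cmp (crel_tens (cxt_assoc W X Y) (crel_id Z))
      (cxt_assoc W (cxt_tens X Y) Z))
    (crel_tens (crel_id W) (cxt_assoc X Y Z)).
Proof. by apply: is_pure_eq; [pure|pure|move=> [w [x [y z]]]]. Qed.

Lemma cxt_triangle (X Y : context) :
  crel_cmp (crel_tens (cxt_runit X) (crel_id Y)) (cxt_assoc X cxt_unit Y) =
  crel_tens (crel_id X) (cxt_lunit Y).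
Proof. by apply: is_pure_eq; [pure|pure|move=> [x [u y]]]. Qed.

Lemma cxt_hexagon (X Y Z : context) :
  crel_cmp (crel_cmp (cxt_assoc Z X Y) (cxt_braid (cxt_tens X Y) Z))
    (cxt_assoc X Y Z) =
  crel_cmp (crel_cmp (crel_tens (cxt_braid X Z) (crel_id Y)) (cxt_assoc X Z Y))
    (crel_tens (crel_id X) (cxt_braid Y Z)).
Proof. by apply: is_pure_eq; [pure|pure|move=> [x [y z]]]. Qed.

Lemma cxt_braidK (X Y : context) :
  crel_cmp (cxt_braid Y X) (cxt_braid X Y) = crel_id (cxt_tens X Y).
Proof. by apply: is_pure_eq; [pure|pure|move=> [x y]]. Qed.

Definition cxt_sym_monoidal : @sym_monoidal Cxt cxt_tens cxt_unit :=
  @SymMonoidal Cxt cxt_tens cxt_unit (@crel_tens)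
    cxt_assoc cxt_lunit cxt_runit cxt_braid
    cxt_tensm1 (@cxt_tensmM) cxt_assoc_iso (@cxt_assoc_nat)
    cxt_lunit_iso (@cxt_lunit_nat) cxt_runit_iso (@cxt_runit_nat)
    (@cxt_braid_nat) cxt_pentagon cxt_triangle cxt_hexagon cxt_braidK.

(** * Discarding on contexts *)

Definition cxt_disc_fun (K : context) (g : gob K) : set (gob cxt_unit) :=
  [set _ | up [set g] <> setT].

Lemma cxt_disc_subproof K (Z : set (gob cxt_unit)) :
  closed Z -> closed (bullet (@cxt_disc_fun K) Z).
Proof.
move=> _; have [Zt|nZt] := pselect (Z tt).
  by apply: (@eq_closed _ (dn set0)); [split=> [x _ []|x _ b []]//|
    exact: closed_dn].
apply: (@eq_closed _ (dn setT)); last exact: closed_dn.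
split=> x h.
  move=> t; case; apply/seteqP; split=> // m _ _ ->; exact: h.
have /contrapT e : ~ (up [set x] <> setT) by move=> /(h tt).
by move=> m _; have /(_ x erefl) : up [set x] m by rewrite e.
Qed.

Definition cxt_disc (K : context) : closed_rel K cxt_unit :=
  ClosedRel (fun g => closed_cxt_unit (cxt_disc_fun g)) (@cxt_disc_subproof K).

Lemma bullet_disc K Z : bullet (cxt_disc K) Z = [set g | Z tt \/ dn setT g].
Proof.
apply/seteqP; split=> g.
  move=> h; have [|nZ] := pselect (Z tt); [by left|right].
  have /contrapT e : ~ (up [set g] <> setT) by move=> /(h tt).
  by move=> m _; have /(_ g erefl) : up [set g] m by rewrite e.
by move=> [Zt []//|h] u; case; apply/seteqP; split=> // m _ _ ->; exact: h.
Qed.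

Lemma cxt_disc_unit : cxt_disc cxt_unit = crel_id cxt_unit.
Proof.
apply: eq_crel => Z cZ; rewrite bullet_disc bullet_pure //.
by apply/seteqP; split=> -[]; [case=> // /(_ tt I)|left].
Qed.

Lemma cxt_disc_tens (A B : context) :
  cxt_disc (cxt_tens A B) =
  crel_cmp (cxt_lunit cxt_unit) (crel_tens (cxt_disc A) (cxt_disc B)).
Proof.
apply: eq_crel => Z cZ; rewrite bullet_cmp // bullet_pure // bullet_tens; last first.
  exact: cxt_lunit_subproof.
rewrite bullet_disc; apply/seteqP; split=> -[x y] /=.
  rewrite bullet_disc /= bullet_disc /= => -[|h]; first tauto.
  have [|nx] := pselect (dn setT x); [tauto|left; right].
  move: nx => /existsNP[m /not_implyP[_ nm]] n _.
  by case: (h (m, n) I).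
rewrite bullet_disc /= bullet_disc /= => -[[|h]|h]; first tauto.
  by right=> m _; right; exact: h.
by right=> m _; left; exact: h.
Qed.

Definition cxt_discarding : discarding cxt_sym_monoidal :=
  @Discarding Cxt cxt_tens cxt_unit cxt_sym_monoidal cxt_disc
    cxt_disc_unit cxt_disc_tens.

(** * Complete lattices *)

(* Having all suprema, such an order also has all infima: see inf. *)
Record suplattice := SupLattice {
  car :> Type;
  le : car -> car -> Prop;
  sup : set car -> car;
  le_refl : forall x, le x x;
  le_trans : forall x y z, le x y -> le y z -> le x z;
  le_anti : forall x y, le x y -> le y x -> x = y;
  supP : forall (A : set car) x, le (sup A) x <-> (forall a, A a -> le a x) }.

Arguments le {s} x y.
Arguments sup {s} A.

Definition inf (V : suplattice) (A : set V) : V :=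
  sup [set x | forall a, A a -> le x a].
Definition bot (V : suplattice) : V := sup set0.
Definition top (V : suplattice) : V := sup setT.

Lemma bot_le (V : suplattice) (v : V) : le (bot V) v.
Proof. by apply/supP. Qed.

Lemma le_bot (V : suplattice) (v : V) : le v (bot V) -> v = bot V.
Proof. by move=> h; apply: le_anti => //; exact: bot_le. Qed.

Record suphom (V W : suplattice) := SupHom {
  shfun :> V -> W;
  shsup : forall A : set V, shfun (sup A) = sup (shfun @` A) }.

Lemma suphomP V W (f g : suphom V W) : f =1 g -> f = g.
Proof.
case: f g => [f hf] [g hg] /= /funext e; subst g.
by rewrite (Prop_irrelevance hf hg).
Qed.

Lemma suphom_id_subproof (V : suplattice) (A : set V) : id (sup A) = sup (id @` A).
Proof. by rewrite image_id. Qed.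

Definition suphom_id (V : suplattice) : suphom V V :=
  SupHom (@suphom_id_subproof V).

Lemma suphom_cmp_subproof U V W (g : suphom V W) (f : suphom U V) (A : set U) :
  (g \o f) (sup A) = sup ((g \o f) @` A).
Proof. by rewrite /= !shsup image_comp. Qed.

Definition suphom_cmp U V W (g : suphom V W) (f : suphom U V) : suphom U W :=
  SupHom (suphom_cmp_subproof g f).

Lemma suphom_cmp1m V W (f : suphom V W) : suphom_cmp (suphom_id W) f = f.
Proof. exact: suphomP. Qed.

Lemma suphom_cmpm1 V W (f : suphom V W) : suphom_cmp f (suphom_id V) = f.
Proof. exact: suphomP. Qed.

Lemma suphom_cmpA U V W X (h : suphom W X) (g : suphom V W) (f : suphom U V) :
  suphom_cmp h (suphom_cmp g f) = suphom_cmp (suphom_cmp h g) f.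
Proof. exact: suphomP. Qed.

Definition SupLat : category :=
  @Category suplattice suphom suphom_id suphom_cmp
    suphom_cmp1m suphom_cmpm1 suphom_cmpA.

(* CLat is the wide subcategory of SupLat on these morphisms. *)
Definition inf_preserving (V W : suplattice) (f : suphom V W) : Prop :=
  forall A : set V, f (inf A) = inf (f @` A).

Lemma two_supP (A : set bool) (x : bool) :
  (`[< A true >] -> x) <-> (forall a, A a -> a -> x).
Proof.
split=> [h [] // At _|h /asboolP At]; first by apply: h; exact/asboolP.
exact: h At isT.
Qed.

Lemma two_anti (x y : bool) : (x -> y) -> (y -> x) -> x = y.
Proof. by move=> xy yx; apply/idP/idP. Qed.

Definition two : suplattice :=
  @SupLattice bool (fun x y => x -> y) (fun A => `[< A true >])
    (fun x xx => xx) (fun x y z xy yz xx => yz (xy xx)) two_anti two_supP.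

(** * Concept lattices *)

Record concept (K : context) := Concept {
  extent : set (gob K);
  intent : set (att K);
  up_extent : up extent = intent;
  dn_intent : dn intent = extent }.

Lemma conceptP K (c d : concept K) : extent c = extent d -> c = d.
Proof.
case: c d => [A B uA dB] [A' B' uA' dB'] /= e.
case: _ / e uA' dB' => uA' dB'; case: _ / uA' dB' => dB'.
by case: _ / uA dB => dB; rewrite (Prop_irrelevance dB dB').
Qed.

(* The concept with extent closure A and intent up A. *)
Definition concept_of K (A : set (gob K)) : concept K :=
  Concept (up_closure A) (erefl (closure A)).

Lemma closed_extent K (c : concept K) : closed (extent c).
Proof. by rewrite /closed /closure up_extent dn_intent. Qed.

Definition concept_le K (c d : concept K) : Prop := extent c `<=` extent d.

Definition concept_sup K (A : set (concept K)) : concept K :=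
  concept_of (\bigcup_(c in A) extent c).

Lemma concept_le_anti K (c d : concept K) :
  concept_le c d -> concept_le d c -> c = d.
Proof. by move=> cd dc; apply: conceptP; apply/seteqP; split. Qed.

Lemma concept_supP K (A : set (concept K)) (x : concept K) :
  concept_le (concept_sup A) x <-> (forall c, A c -> concept_le c x).
Proof.
rewrite /concept_le /= closure_sub; last exact: closed_extent.
by split=> [h c Ac g cg|h g [c Ac cg]]; [apply: h; exists c|exact: h cg].
Qed.

Definition concept_lattice (K : context) : suplattice :=
  @SupLattice (concept K) (@concept_le K) (@concept_sup K)
    (fun c => @subset_refl _ (extent c))
    (fun c d e => @subset_trans _ (extent d) (extent c) (extent e))
    (@concept_le_anti K) (@concept_supP K).

(** * The functors B and F *)

Definition B_map_fun K1 K2 (R : closed_rel K1 K2)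
    (c : concept_lattice K1) : concept_lattice K2 :=
  concept_of (rimage R (extent c)).

Lemma B_map_sub K1 K2 (R : closed_rel K1 K2) c Z : closed Z ->
  (extent (B_map_fun R c) `<=` Z) <-> (extent c `<=` bullet R Z).
Proof. by move=> cZ; rewrite closure_sub // rimage_sub. Qed.

Lemma B_map_subproof K1 K2 (R : closed_rel K1 K2)
    (A : set (concept_lattice K1)) :
  B_map_fun R (sup A) = sup (B_map_fun R @` A).
Proof.
apply: conceptP; apply: closed_eq => [||Z cZ]; try exact: closed_extent.
rewrite B_map_sub // !closure_sub //; last exact: rel_bullet.
split=> [h h2 [_ [c Ac <-]]|h g [c Ac cg]].
  by move: h2; apply/(B_map_sub R c cZ) => g cg; apply: h; exists c.
apply: (iffLR (B_map_sub R c cZ)) cg => x cx; apply: h.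
by exists (B_map_fun R c) => //; exists c.
Qed.

Definition B_map K1 K2 (R : closed_rel K1 K2) :
    suphom (concept_lattice K1) (concept_lattice K2) :=
  SupHom (@B_map_subproof K1 K2 R).

Lemma B_map1 K : B_map (crel_id K) = suphom_id (concept_lattice K).
Proof.
apply: suphomP => c; apply: conceptP.
apply: closed_eq => [||Z cZ]; try exact: closed_extent.
by rewrite B_map_sub // bullet_pure.
Qed.

Lemma B_mapM K1 K2 K3 (S : closed_rel K2 K3) (R : closed_rel K1 K2) :
  B_map (crel_cmp S R) = suphom_cmp (B_map S) (B_map R).
Proof.
apply: suphomP => c; apply: conceptP.
apply: closed_eq => [||Z cZ]; try exact: closed_extent.
rewrite !B_map_sub // ?bullet_cmp //; exact: rel_bullet.
Qed.

Definition B_functor : functor Cxt SupLat :=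
  @Functor Cxt SupLat concept_lattice B_map B_map1 (@B_mapM).

Definition F_obj (V : suplattice) : context := @Context V V (@le V).

Lemma F_closureE (V : suplattice) (A : set V) :
  @closure (F_obj V) A = [set x | le x (sup A)].
Proof.
apply/seteqP; split=> x /=; first by apply=> a; exact: (iffLR (supP A _)) (le_refl _) a.
by move=> xA m Am; apply: le_trans xA _; apply/supP.
Qed.

Lemma F_map_subproof V W (f : suphom V W) (Z : set (gob (F_obj W))) :
  closed Z -> closed (f @^-1` Z : set (gob (F_obj V))).
Proof.
move=> cZ; apply/seteqP; split; last exact: sub_closure.
rewrite F_closureE => x /= xZ; rewrite -cZ F_closureE /=.
suff : le (f x) (f (sup (f @^-1` Z))).
  move=> h; apply: le_trans h _; rewrite shsup; apply/supP => _ [z Zz <-].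
  exact: (iffLR (supP Z _)) (le_refl _) _ Zz.
have <- : sup [set x; sup (f @^-1` Z)] = sup (f @^-1` Z).
  apply: le_anti; first by apply/supP => _ [->|->] //; exact: le_refl.
  by apply: (iffLR (supP _ _)) (le_refl _) _ _; right.
rewrite shsup; apply: (iffLR (supP _ _)) (le_refl _) _ _.
by exists x => //; left.
Qed.

Definition F_map V W (f : suphom V W) : closed_rel (F_obj V) (F_obj W) :=
  pure_rel (@F_map_subproof V W f).

Lemma F_map1 V : F_map (suphom_id V) = crel_id (F_obj V).
Proof. by apply: is_pure_eq; [pure|pure|]. Qed.

Lemma F_mapM U V W (g : suphom V W) (f : suphom U V) :
  F_map (suphom_cmp g f) = crel_cmp (F_map g) (F_map f).
Proof. by apply: is_pure_eq; [pure|pure|]. Qed.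

Definition F_functor : functor SupLat Cxt :=
  @Functor SupLat Cxt F_obj F_map F_map1 (@F_mapM).

(** * The concept tensor of complete lattices *)

Definition tensor_context (V1 V2 : suplattice) : context :=
  @Context (V1 * V2) (V1 * V2) (fun p q => le p.1 q.1 \/ le p.2 q.2).

Definition concept_tensor (V1 V2 : suplattice) : suplattice :=
  concept_lattice (tensor_context V1 V2).

Section PureTensor.
Variables (V1 V2 : suplattice) (x : V1) (y : V2).

Definition odot_extent : set (gob (tensor_context V1 V2)) :=
  [set p | [\/ le p.1 x /\ le p.2 y, p.1 = bot V1 | p.2 = bot V2]].

Lemma odot_subproof : dn (up odot_extent) = odot_extent.
Proof.
apply/seteqP; split; last exact: sub_closure.
move=> [w z] h.
have h1 : le w x \/ le z (bot V2).
  apply: (h (x, bot V2)) => -[a b] [[/= ax bY]|/= ->|/= ->]; first by left.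
    by left; exact: bot_le.
  by right; exact: le_refl.
have h2 : le w (bot V1) \/ le z y.
  apply: (h (bot V1, y)) => -[a b] [[/= ax bY]|/= ->|/= ->]; first by right.
    by left; exact: le_refl.
  by right; exact: bot_le.
case: h1 => [wx|/le_bot]; last by constructor 3.
by case: h2 => [/le_bot|zy]; [constructor 2|constructor 1].
Qed.

Definition odot : concept_tensor V1 V2 :=
  @Concept (tensor_context V1 V2) odot_extent (up odot_extent) erefl odot_subproof.

End PureTensor.

Notation "x ⊙ y" := (odot x y) (at level 40, left associativity) : cat_scope.

(* The symmetric monoidal structure maps of the concept tensor.  Pure tensors
   generate V1 ⊗ V2 under suprema, so these equations determine all of them. *)
Record is_concept_tensor_structure
    (S : @sym_monoidal SupLat concept_tensor two) : Prop :=
  IsConceptTensorStructure {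
  odot_tensm : forall (V1 W1 V2 W2 : suplattice)
      (f : suphom V1 W1) (g : suphom V2 W2),
    unique (fun h : suphom (concept_tensor V1 V2) (concept_tensor W1 W2) =>
              forall x y, h (x ⊙ y) = f x ⊙ g y)
           (tensm S f g);
  odot_assoc : forall (V1 V2 V3 : suplattice) (x : V1) (y : V2) (z : V3),
    (assoc S V1 V2 V3 : suphom _ _) (x ⊙ (y ⊙ z)) = (x ⊙ y) ⊙ z;
  odot_lunit : forall (V : suplattice) (x : V),
    (lunit S V : suphom _ _) ((top two : two) ⊙ x) = x;
  odot_runit : forall (V : suplattice) (x : V),
    (runit S V : suphom _ _) (x ⊙ (top two : two)) = x;
  odot_braid : forall (V1 V2 : suplattice) (x : V1) (y : V2),
    (braid S V1 V2 : suphom _ _) (x ⊙ y) = y ⊙ x }.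

Definition is_suplat_discarding
    (S : @sym_monoidal SupLat concept_tensor two) (d : discarding S) : Prop :=
  forall (V : suplattice) (x : V),
    (d V : suphom V two) x = top two <-> x <> bot V.

(* Main.v *)
(** [B] and [F] are quasi-inverse to each other through [eta : K -> F (B K)], given
    by [g |-> gen g] with [gen g] the concept generated by [g], and
    [eps : B (F V) -> V], the supremum of the extent.  The concept tensor [V ⊗ W]
    is [B (F V ⊗ F W)] and [x ⊙ y] is [gen (x, y)], so the structure maps on
    lattices come from those on contexts through [B], [eta] and [eps].  Since [⊙] preserves suprema in each
    variable, maps out of iterated tensors agree as soon as they agree on pure
    tensors (or on tensors of concepts [gen g]), where all coherence laws are
    immediate. *)

Require Import Defs.
From mathcomp Require Import all_boot.
From mathcomp Require Import boolp classical_sets.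
Import Defs.

Set Implicit Arguments.
Unset Strict Implicit.
Unset Printing Implicit Defensive.

Local Open Scope classical_set_scope.
Local Open Scope cat_scope.

(** * Isomorphisms *)

Section Isomorphisms.
Variable C : category.

Lemma is_iso_idm (A : C) : is_iso (idm A).
Proof. by exists (idm A); rewrite cmp1m. Qed.

Lemma is_iso_cmp (X Y Z : C) (g : hom Y Z) (f : hom X Y) :
  is_iso g -> is_iso f -> is_iso (g ∘ f).
Proof.
move=> [g' [g'g gg']] [f' [f'f ff']]; exists (f' ∘ g'); split.
  by rewrite -cmpA (cmpA g') g'g cmp1m f'f.
by rewrite -cmpA (cmpA f) ff' cmp1m gg'.
Qed.

Lemma is_iso_fmap (D : category) (F : functor C D) (A B : C) (f : hom A B) :
  is_iso f -> is_iso (fmap F f).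
Proof. by move=> [g [gf fg]]; exists (fmap F g); rewrite -!fmapM gf fg !fmap1. Qed.

Lemma is_iso_tensm (t : C -> C -> C) (I : C) (S : sym_monoidal t I)
    (A1 B1 A2 B2 : C) (f : hom A1 B1) (g : hom A2 B2) :
  is_iso f -> is_iso g -> is_iso (tensm S f g).
Proof.
move=> [f' [f'f ff']] [g' [g'g gg']]; exists (tensm S f' g').
by rewrite -!tensmM f'f ff' g'g gg' !tensm1.
Qed.

End Isomorphisms.

(** * Complete lattices *)

Section SupLattices.
Implicit Types V W : suplattice.

(** Yoneda form of antisymmetry: [supP] describes a supremum by its upper bounds, so equalities of
    suprema are proved by comparing these. *)
Lemma eq_le_above V (x y : V) : (forall v, le x v <-> le y v) -> x = y.
Proof. by move=> h; apply: le_anti; apply/h; exact: le_refl. Qed.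

Lemma le_sup V (A : set V) x : A x -> le x (sup A).
Proof. exact: (iffLR (supP A _) (le_refl _)). Qed.

Lemma sup1 V (x : V) : sup [set x] = x.
Proof. by apply: eq_le_above => v; rewrite supP; split=> [h|h _ -> //]; exact: h. Qed.

(** [x ≤ y] amounts to [sup {x, y} = y], an equation that a sup-preserving map transports. *)
Lemma suphom_le V W (f : suphom V W) x y : le x y -> le (f x) (f y).
Proof.
move=> xy; have <- : sup [set x; y] = y.
  apply: le_anti; first by apply/supP => _ [->|->] //; exact: le_refl.
  by apply: le_sup; right.
by rewrite shsup; apply: le_sup; exists x => //; left.
Qed.

Lemma suphom_bot V W (f : suphom V W) : f (bot V) = bot W.
Proof. by rewrite /bot shsup image_set0. Qed.

Lemma top_two : top two = true.
Proof. exact/asboolP. Qed.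

Lemma bot_two : bot two = false.
Proof. by apply/asboolP. Qed.

Lemma suphom_cmpE U V W (g : suphom V W) (f : suphom U V) x :
  (suphom_cmp g f) x = g (f x).
Proof. by []. Qed.

Lemma suphom_idE V x : suphom_id V x = x.
Proof. by []. Qed.

Lemma inf_le V (A : set V) x : A x -> le (inf A) x.
Proof. by move=> Ax; apply/supP => y; apply. Qed.

Lemma le_inf V (A : set V) x : (forall a, A a -> le x a) -> le x (inf A).
Proof. exact: le_sup. Qed.

(** Adjoint functor theorem for complete lattices: [l w] is the infimum of all [v] with
    [w ≤ f v]. *)
Lemma inf_preservingP V W (f : suphom V W) :
  inf_preserving f <->
  exists l : W -> V, forall w v, le (l w) v <-> le w (f v).
Proof.
split=> [hf|[l lf] A].
  exists (fun w => inf [set v | le w (f v)]) => w v; split=> h; last exact: inf_le.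
  apply: le_trans (suphom_le f h); rewrite hf.
  by apply: le_inf => _ [v' wv' <-].
apply: le_anti.
  by apply: le_inf => _ [v Av <-]; exact/suphom_le/inf_le.
apply/lf/le_inf => a Aa; apply/lf/inf_le; by exists a.
Qed.

(** The inverse of an order isomorphism is also its left adjoint. *)
Lemma is_iso_inf_preserving V W (f : suphom V W) :
  is_iso (f : @hom SupLat V W) -> @iso_within SupLat inf_preserving V W f.
Proof.
move=> [g [gf fg]].
have gfE v : (g : suphom W V) (f v) = v.
  exact: (congr1 (fun h : @hom SupLat V V => (h : suphom V V) v) gf).
have fgE w : f ((g : suphom W V) w) = w.
  exact: (congr1 (fun h : @hom SupLat W W => (h : suphom W W) w) fg).
split; first apply/inf_preservingP.
  exists (g : suphom W V) => w v; split=> [/(suphom_le f)|/(suphom_le g)].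
    by rewrite fgE.
  by rewrite gfE.
exists g; split=> //; apply/inf_preservingP; exists f => w v.
split=> [/(suphom_le g)|/(suphom_le f)]; first by rewrite gfE.
by rewrite fgE.
Qed.

(** A jointly epimorphic family. Stated by this property rather than by generation under suprema,
    density passes directly to tensors. *)
Definition dense T V (d : T -> V) : Prop :=
  forall W (f g : suphom V W), (forall t, f (d t) = g (d t)) -> f = g.

Lemma dense_id V : dense (@id V).
Proof. by move=> W f g; exact: suphomP. Qed.

Lemma dense_true : dense (fun _ : unit => true : two).
Proof.
move=> W f g h; apply: suphomP => -[]; first exact: h tt.
by rewrite -bot_two !suphom_bot.
Qed.

End SupLattices.

(** * The equivalence of categories *)

Definition gen (K : context) (g : gob K) : concept_lattice K := concept_of [set g].

(** [closure [set g]] is the least closed set containing [g]. *)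
Lemma gen_le (K : context) (g : gob K) (c : concept_lattice K) :
  le (gen g) c <-> extent c g.
Proof.
rewrite /= /concept_le /= closure_sub; last exact: closed_extent.
by split=> [h|h _ -> //]; exact: h.
Qed.

Lemma concept_le_gen (K : context) (c d : concept_lattice K) :
  le c d <-> forall g, extent c g -> le (gen g) d.
Proof. by split=> h g; [move=> /h /gen_le|move=> /h /gen_le]. Qed.

Lemma concept_sup_gen (K : context) (c : concept_lattice K) :
  c = sup (@gen K @` extent c).
Proof.
apply: eq_le_above => v; rewrite supP concept_le_gen.
by split=> [h _ [g cg <-]|h g cg]; apply: h => //; exists g.
Qed.

Lemma dense_gen K : dense (@gen K).
Proof.
move=> W f g h; apply: suphomP => c; rewrite (concept_sup_gen c) !shsup.
by rewrite !image_comp; congr sup; apply: eq_imagel => x _; exact: h.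
Qed.

(** A closed set of [F V] is a principal down-set, namely that of its supremum. *)
Lemma closed_sup (V : suplattice) (Z : set V) (A : set V) :
  @closed (F_obj V) Z -> Z (sup A) <-> A `<=` Z.
Proof.
move=> cZ; rewrite -cZ F_closureE /=.
by split=> [h a Aa|h]; [exact: le_trans (le_sup Aa) h|apply/supP].
Qed.

Lemma B_map_gen K1 K2 (R : closed_rel K1 K2) (phi : gob K1 -> gob K2) g :
  is_pure R phi -> B_map R (gen g) = gen (phi g).
Proof.
move=> hR; apply: conceptP.
apply: closed_eq => [||Z cZ]; try exact: closed_extent.
rewrite B_map_sub // hR // !closure_sub //; last by rewrite -hR //; exact: rel_bullet.
by split=> h _ ->; exact: h.
Qed.

(** Here [R] is arbitrary: since [bullet R Z] is closed, it contains [closure [set g]] as soon as it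
    contains [g]. *)
Lemma extent_B_map_gen K1 K2 (R : closed_rel K1 K2) g :
  extent (B_map R (gen g)) = R g.
Proof.
apply: closed_eq => [||Z cZ]; [exact: closed_extent|exact: rel_closed|].
rewrite B_map_sub // closure_sub; last exact: rel_bullet.
by split=> [|h _ ->//]; exact.
Qed.

(** [Z] is the down-set of [sup Z], so its preimage under [gen] is the extent of [sup Z]. *)
Lemma gen_closed K (Z : set (concept_lattice K)) :
  @closed (F_obj (concept_lattice K)) Z -> closed (@gen K @^-1` Z).
Proof.
move=> cZ; apply: eq_closed (closed_extent (sup Z)).
have ZE c : Z c <-> le c (sup Z) by rewrite -{1}cZ F_closureE.
by split=> g; rewrite /= ZE gen_le.
Qed.

(** [c] is the supremum of the generators in its extent, so [closed_sup] tests membership on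
    these. *)
Lemma closed_genP K (Z : set (concept_lattice K)) c :
  @closed (F_obj (concept_lattice K)) Z ->
  Z c <-> extent c `<=` @gen K @^-1` Z.
Proof.
move=> cZ; have := closed_sup (@gen K @` extent c) cZ.
rewrite -concept_sup_gen => ->.
by split=> [h g cg|h _ [g /h ? <-] //]; apply: h; exists g.
Qed.

(** * The unit of the equivalence and its inverse *)

Definition eta K : closed_rel K (F_obj (concept_lattice K)) :=
  @pure_rel K (F_obj (concept_lattice K)) (@gen K) (@gen_closed K).

Lemma is_pure_id K : is_pure (crel_id K) id.
Proof. exact: is_pure_pure. Qed.

Lemma is_pure_eta K : is_pure (eta K) (@gen K).
Proof. exact: is_pure_pure. Qed.

(** The set in question is the principal down-set of the concept generated by [Z]. *)
Lemma eta_inv_subproof K (Z : set (gob K)) : closed Z ->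
  @closed (F_obj (concept_lattice K)) (bullet (@extent K) Z).
Proof.
move=> cZ; suff -> : bullet (@extent K) Z =
    @dn (F_obj (concept_lattice K)) [set concept_of Z] by exact: closed_dn.
apply/seteqP; split=> c.
  by move=> h _ ->; rewrite /= /concept_le /= cZ.
by move=> /(_ _ erefl); rewrite /= /concept_le /= cZ.
Qed.

Definition eta_inv K : closed_rel (F_obj (concept_lattice K)) K :=
  @ClosedRel (F_obj (concept_lattice K)) K (@extent K) (@closed_extent K)
    (@eta_inv_subproof K).

Lemma etaK K : crel_cmp (eta_inv K) (eta K) = crel_id K.
Proof.
apply: eq_crel => Z cZ; have cE := rel_bullet (eta_inv K) cZ.
rewrite bullet_cmp // !bullet_pure //.
apply/seteqP; split=> g /=; first by move/(closure_sub _ cZ); exact.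
by move=> Zg; apply/closure_sub => // _ ->.
Qed.

Lemma eta_invK K : crel_cmp (eta K) (eta_inv K) = crel_id _.
Proof.
apply: eq_crel => Z cZ; rewrite bullet_cmp // !bullet_pure //.
by apply/seteqP; split=> c /(closed_genP _ cZ).
Qed.

Lemma eta_iso K : is_iso (eta K : @hom Cxt _ _).
Proof. by exists (eta_inv K); split; [exact: etaK|exact: eta_invK]. Qed.

Lemma eta_inv_iso K : is_iso (eta_inv K : @hom Cxt _ _).
Proof. by exists (eta K); split; [exact: eta_invK|exact: etaK]. Qed.

(** [R] need not be induced by a function, so the sides are compared through [bullet]: by
    [closed_genP], both ask that [R g] lie in the preimage of [Z] under [gen]. *)
Lemma eta_nat K L (R : closed_rel K L) :
  crel_cmp (eta L) R = crel_cmp (F_map (B_map R)) (eta K).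
Proof.
apply: eq_crel => Z cZ; have cE := rel_bullet (F_map (B_map R)) cZ.
rewrite !bullet_cmp // !bullet_pure //; last exact: F_map_subproof.
apply/seteqP; split=> g; last first.
  by move=> /(closed_genP _ cZ); rewrite extent_B_map_gen.
by move=> h; apply/(closed_genP _ cZ); rewrite extent_B_map_gen.
Qed.

Lemma eta_inv_nat K L (R : closed_rel K L) :
  crel_cmp (eta_inv L) (F_map (B_map R)) = crel_cmp R (eta_inv K).
Proof.
rewrite -[LHS]crel_cmpm1 -(eta_invK K) crel_cmpA -(crel_cmpA (eta_inv L)) -eta_nat.
by rewrite !crel_cmpA etaK crel_cmp1m.
Qed.

(** * The counit of the equivalence *)

Section Counit.
Variable V : suplattice.

Definition eps_fun (c : concept_lattice (F_obj V)) : V := sup (extent c : set V).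

(** [eps_fun] is left adjoint to [gen], whence it preserves suprema. *)
Lemma eps_fun_le c v :
  le (eps_fun c) v <-> le c (@gen (F_obj V) v).
Proof.
by rewrite supP /= /concept_le /= F_closureE sup1.
Qed.

Lemma eps_subproof A : eps_fun (sup A) = sup (eps_fun @` A).
Proof.
apply: eq_le_above => v; rewrite eps_fun_le !supP.
split=> [h _ [c Ac <-]|h c Ac]; apply/eps_fun_le; first exact: h.
by apply: h; exists c.
Qed.

Definition eps : suphom (concept_lattice (F_obj V)) V := SupHom eps_subproof.

Lemma eps_gen v : eps (@gen (F_obj V) v) = v.
Proof.
rewrite /= /eps_fun /= F_closureE sup1; apply: eq_le_above => u; rewrite supP.
by split=> [|h w wv]; [apply; exact: le_refl|exact: le_trans h].
Qed.

(** Extents over [F V] are principal down-sets, so they contain [sup A] as soon as they contain [A].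
    This makes [gen] a morphism, inverse to [eps]. *)
Lemma gen_sup A : @gen (F_obj V) (sup A) = sup (@gen (F_obj V) @` A).
Proof.
apply: eq_le_above => c; rewrite gen_le supP closed_sup; last exact: closed_extent.
split=> [h _ [v Av <-]|h v Av]; first exact/gen_le/h.
by apply/gen_le/h; exists v.
Qed.

Lemma eps_iso : is_iso (eps : @hom SupLat _ _).
Proof.
exists (SupHom gen_sup : suphom V (concept_lattice (F_obj V))); split.
  by apply: (@dense_gen (F_obj V)) => v; exact: (congr1 (@gen (F_obj V)) (eps_gen v)).
by apply: suphomP => v; exact: eps_gen.
Qed.

End Counit.

Lemma eps_nat V W (f : suphom V W) :
  suphom_cmp (eps W) (B_map (F_map f)) = suphom_cmp f (eps V).
Proof.
apply: (@dense_gen (F_obj V)) => v; rewrite !suphom_cmpE.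
rewrite eps_gen -[RHS]eps_gen; congr (eps W _).
by apply: (@B_map_gen (F_obj V) (F_obj W) _ f); exact: is_pure_pure.
Qed.

(** * The tensor product of complete lattices *)

Section Odot.
Variables V W : suplattice.

(** A closed set containing [(x, y)] also contains every pair below it and every pair with a bottom
    component, because these satisfy all its attributes. *)
Lemma odotE (x : V) (y : W) : x ⊙ y = @gen (tensor_context V W) (x, y).
Proof.
apply: conceptP; apply: closed_eq => [||Z cZ]; [exact: odot_subproof| |].
  exact: closed_closure.
rewrite closure_sub //; split=> [h _ ->|h].
  by apply: h; constructor 1; split; exact: le_refl.
move=> -[w z] hwz; rewrite -cZ => -[m n] /(_ _ (h _ erefl)) /=.
move=> xy; case: hwz => /= [[wx zy]|->|->]; last by right; exact: bot_le.
  by case: xy => [xm|yn]; [left; exact: le_trans xm|right; exact: le_trans yn].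
by left; exact: bot_le.
Qed.

Lemma odot_le (x : V) (y : W) (c : concept_tensor V W) :
  le (x ⊙ y) c <-> extent c (x, y).
Proof. by rewrite odotE gen_le. Qed.

(** Sections of closed sets are closed, so by [closed_sup] such a section contains [sup A] once it
    contains [A]. *)
Lemma odotr_sup (x : V) (A : set W) : x ⊙ sup A = sup (odot x @` A).
Proof.
apply: eq_le_above => c; rewrite odot_le supP.
have -> : extent c (x, sup A) <-> A `<=` [set y | extent c (x, y)].
  exact/closed_sup/(@closed_secr (F_obj V) (F_obj W))/closed_extent.
split=> [h _ [y Ay <-]|h y Ay]; first by apply/odot_le; exact: h.
by apply/odot_le/h; exists y.
Qed.

Lemma odotl_sup (A : set V) (y : W) : sup A ⊙ y = sup ((fun x => x ⊙ y) @` A).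
Proof.
apply: eq_le_above => c; rewrite odot_le supP.
have -> : extent c (sup A, y) <-> A `<=` [set x | extent c (x, y)].
  exact: (closed_sup A (@closed_secl (F_obj V) (F_obj W) _ y (closed_extent c))).
split=> [h _ [x Ax <-]|h x Ax]; first by apply/odot_le; exact: h.
by apply/odot_le/h; exists x.
Qed.

Lemma odot_botl (y : W) : bot V ⊙ y = bot (concept_tensor V W).
Proof. by rewrite /bot odotl_sup image_set0. Qed.

Lemma odot_botr (x : V) : x ⊙ bot W = bot (concept_tensor V W).
Proof. by rewrite /bot odotr_sup image_set0. Qed.

(** The absence of zero divisors, which makes discarding compatible with the tensor. *)
Lemma odot_eq_bot (x : V) (y : W) :
  x ⊙ y = bot (concept_tensor V W) <-> x = bot V \/ y = bot W.
Proof.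
split=> [e|[->|->]]; [|exact: odot_botl|exact: odot_botr].
have /odot_le h : le (x ⊙ y) (bot (concept_tensor V W)) by rewrite e; exact: le_refl.
(* Objects of the bottom concept satisfy every attribute; the attribute [(bot V, bot W)] is the
   decisive one. *)
have [p [c []]|/le_bot|/le_bot] := h (bot V, bot W); by [left|right].
Qed.

(** As [⊙] preserves suprema in each variable, density can be applied to one variable at a time. *)
Lemma dense_odot T1 T2 (d1 : T1 -> V) (d2 : T2 -> W) :
  dense d1 -> dense d2 -> dense (fun t => d1 t.1 ⊙ d2 t.2).
Proof.
move=> h1 h2 U f g e; apply: (@dense_gen (tensor_context V W)) => -[x y].
rewrite -odotE.
(* The first variable becomes arbitrary while the second stays in its family; [r] below then frees
   the second. *)
have e1 t2 z : f (z ⊙ d2 t2) = g (z ⊙ d2 t2).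
  pose l := SupHom (fun A => odotl_sup A (d2 t2)).
  suff /(congr1 (fun h : suphom _ _ => h z)) : suphom_cmp f l = suphom_cmp g l by [].
  by apply: h1 => t1; exact: (e (t1, t2)).
pose r := SupHom (odotr_sup x).
suff /(congr1 (fun h : suphom _ _ => h y)) : suphom_cmp f r = suphom_cmp g r by [].
by apply: h2 => t2; exact: e1.
Qed.

End Odot.

(** * The symmetric monoidal structure on complete lattices *)

Section LatTensm.
Variables (V1 W1 V2 W2 : suplattice) (f : suphom V1 W1) (g : suphom V2 W2).

(** [tensor_context V1 V2] is convertible to [cxt_tens (F_obj V1) (F_obj V2)], so [B_map] has the
    required type. *)
Definition lat_tensm : suphom (concept_tensor V1 V2) (concept_tensor W1 W2) :=
  B_map (crel_tens (F_map f) (F_map g)).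

Lemma lat_tensm_odot x y : lat_tensm (x ⊙ y) = f x ⊙ g y.
Proof.
rewrite !odotE.
apply: (@B_map_gen _ _ (crel_tens (F_map f) (F_map g)) (fun p => (f p.1, g p.2))).
by apply: is_pure_tens; exact: is_pure_pure.
Qed.

End LatTensm.

(** * The unit context and the lattice [two] *)

Definition nuF : closed_rel cxt_unit (F_obj two) :=
  @pure_rel cxt_unit (F_obj two) (fun _ => true) (fun _ _ => closed_cxt_unit _).

(** The set in question is the principal down-set of the truth value of [Z tt]. *)
Lemma nuF_inv_subproof (Z : set (gob cxt_unit)) : closed Z ->
  @closed (F_obj two) (bullet (fun b : bool => [set _ | b]) Z).
Proof.
move=> _; suff -> : bullet (fun b : bool => [set _ | b]) Z =
    @dn (F_obj two) [set `[< Z tt >]] by exact: closed_dn.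
apply/seteqP; split=> b /=; first by move=> h _ -> /= /h ?; exact/asboolP.
by move=> /(_ _ erefl) /= h [] /h /asboolP.
Qed.

Definition nuF_inv : closed_rel (F_obj two) cxt_unit :=
  @ClosedRel (F_obj two) cxt_unit (fun b : bool => [set _ | b])
    (fun _ => closed_cxt_unit _) nuF_inv_subproof.

Lemma is_pure_nuF : is_pure nuF (fun _ => true).
Proof. exact: is_pure_pure. Qed.

Lemma nuFK : crel_cmp nuF_inv nuF = crel_id cxt_unit.
Proof.
apply: eq_crel => Z cZ; have cE := rel_bullet nuF_inv cZ.
rewrite bullet_cmp // !bullet_pure //.
by apply/seteqP; split=> -[] h; [exact: h|case].
Qed.

Lemma closed_two (Z : set (gob (F_obj two))) : closed Z -> Z false.
Proof. by move=> <-; rewrite F_closureE. Qed.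

Lemma nuF_invK : crel_cmp nuF nuF_inv = crel_id (F_obj two).
Proof.
apply: eq_crel => Z cZ; rewrite bullet_cmp // !bullet_pure //.
have Z0 := closed_two cZ.
by apply/seteqP; split=> -[] // h; [exact: (h tt isT)|case].
Qed.

Lemma nuF_iso : is_iso (nuF : @hom Cxt _ _).
Proof. by exists nuF_inv; split; [exact: nuFK|exact: nuF_invK]. Qed.

Lemma nuF_inv_iso : is_iso (nuF_inv : @hom Cxt _ _).
Proof. by exists nuF; split; [exact: nuF_invK|exact: nuFK]. Qed.

(* The inverse isomorphisms [eta_inv] and [nuF_inv] are not induced by functions;
   a map [B_map (R ∘ j)] with [j] such an inverse is computed on the generators
   [gen (phi g)], where [phi] induces the inverse of [j]. *)
Lemma B_map_cmp_gen K K' L (R : closed_rel K L) (j : closed_rel K' K)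
    (i : closed_rel K K') (phi : gob K -> gob K') (psi : gob K -> gob L) g :
  crel_cmp j i = crel_id K -> is_pure i phi -> is_pure R psi ->
  B_map (crel_cmp R j) (gen (phi g)) = gen (psi g).
Proof.
move=> ji hi hR; rewrite -(B_map_gen g hi).
change (suphom_cmp (B_map (crel_cmp R j)) (B_map i) (gen g) = gen (psi g)).
by rewrite -B_mapM -crel_cmpA ji crel_cmpm1; exact: B_map_gen.
Qed.

(** The inner tensor occurs as an [F (B K)]: [eta_inv] unwraps it, the contexts are reassociated,
    and [eta] wraps the new inner tensor. *)
Definition lat_assoc (V1 V2 V3 : suplattice) :
    suphom (concept_tensor V1 (concept_tensor V2 V3))
           (concept_tensor (concept_tensor V1 V2) V3) :=
  B_map (crel_cmp
    (crel_cmp (crel_tens (eta (cxt_tens (F_obj V1) (F_obj V2))) (crel_id (F_obj V3)))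
       (cxt_assoc (F_obj V1) (F_obj V2) (F_obj V3)))
    (crel_tens (crel_id (F_obj V1)) (eta_inv (cxt_tens (F_obj V2) (F_obj V3))))).

Lemma lat_assoc_odot (V1 V2 V3 : suplattice) (x : V1) (y : V2) (z : V3) :
  lat_assoc V1 V2 V3 (x ⊙ (y ⊙ z)) = (x ⊙ y) ⊙ z.
Proof.
rewrite !odotE.
apply: (@B_map_cmp_gen (cxt_tens (F_obj V1) (cxt_tens (F_obj V2) (F_obj V3)))
  (cxt_tens (F_obj V1) (F_obj (concept_tensor V2 V3)))
  (cxt_tens (F_obj (concept_tensor V1 V2)) (F_obj V3)) _ _
  (crel_tens (crel_id (F_obj V1)) (eta (cxt_tens (F_obj V2) (F_obj V3))))
  (fun g => (g.1, @gen (cxt_tens (F_obj V2) (F_obj V3)) g.2))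
  (fun g => (@gen (cxt_tens (F_obj V1) (F_obj V2)) (g.1, g.2.1), g.2.2))
  (x, (y, z))).
- by rewrite -cxt_tensmM etaK crel_cmp1m cxt_tensm1.
- exact: (is_pure_tens (@is_pure_id (F_obj V1))
    (@is_pure_eta (cxt_tens (F_obj V2) (F_obj V3)))).
- exact: (is_pure_cmp (is_pure_pure (@cxt_assoc_subproof (F_obj V1) (F_obj V2) (F_obj V3)))
    (is_pure_tens (@is_pure_eta (cxt_tens (F_obj V1) (F_obj V2)))
      (@is_pure_id (F_obj V3)))).
Qed.

(** [nuF_inv] turns [F two] into the unit context; the result lies in [B (F V)], which [eps]
    identifies with [V]. *)
Definition lat_lunit (V : suplattice) : suphom (concept_tensor two V) V :=
  suphom_cmp (eps V)
    (B_map (crel_cmp (cxt_lunit (F_obj V)) (crel_tens nuF_inv (crel_id (F_obj V))))).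

Lemma lat_lunit_odot (V : suplattice) (x : V) : lat_lunit V ((true : two) ⊙ x) = x.
Proof.
rewrite odotE suphom_cmpE -[RHS]eps_gen; congr (eps V _).
apply: (@B_map_cmp_gen (cxt_tens cxt_unit (F_obj V))
  (cxt_tens (F_obj two) (F_obj V)) (F_obj V) _ _
  (crel_tens nuF (crel_id (F_obj V))) (fun g => (true, g.2)) snd (tt, x)).
- by rewrite -cxt_tensmM nuFK crel_cmp1m cxt_tensm1.
- exact: (is_pure_tens is_pure_nuF (@is_pure_id (F_obj V))).
- exact: is_pure_pure.
Qed.

Definition lat_runit (V : suplattice) : suphom (concept_tensor V two) V :=
  suphom_cmp (eps V)
    (B_map (crel_cmp (cxt_runit (F_obj V)) (crel_tens (crel_id (F_obj V)) nuF_inv))).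

Lemma lat_runit_odot (V : suplattice) (x : V) : lat_runit V (x ⊙ (true : two)) = x.
Proof.
rewrite odotE suphom_cmpE -[RHS]eps_gen; congr (eps V _).
apply: (@B_map_cmp_gen (cxt_tens (F_obj V) cxt_unit)
  (cxt_tens (F_obj V) (F_obj two)) (F_obj V) _ _
  (crel_tens (crel_id (F_obj V)) nuF) (fun g => (g.1, true)) fst (x, tt)).
- by rewrite -cxt_tensmM nuFK crel_cmp1m cxt_tensm1.
- exact: (is_pure_tens (@is_pure_id (F_obj V)) is_pure_nuF).
- exact: is_pure_pure.
Qed.

Definition lat_braid (V W : suplattice) :
    suphom (concept_tensor V W) (concept_tensor W V) :=
  B_map (cxt_braid (F_obj V) (F_obj W)).

Lemma lat_braid_odot (V W : suplattice) (x : V) (y : W) : lat_braid V W (x ⊙ y) = y ⊙ x.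
Proof.
rewrite !odotE.
apply: (@B_map_gen _ _ (cxt_braid (F_obj V) (F_obj W)) (fun g => (g.2, g.1)) (x, y)).
exact: is_pure_pure.
Qed.

(* [suphom_cmpE] comes last because it also matches [lat_lunit] and [lat_runit]. *)
Definition latE := (lat_tensm_odot, lat_assoc_odot, lat_lunit_odot,
  lat_runit_odot, lat_braid_odot, suphom_idE, suphom_cmpE).

(** * Naturality and coherence, checked on pure tensors *)

Lemma dense_odot2 (V W : suplattice) : dense (fun t : V * W => t.1 ⊙ t.2).
Proof. exact: dense_odot (@dense_id V) (@dense_id W). Qed.

Lemma dense_odot3 (V1 V2 V3 : suplattice) :
  dense (fun t : V1 * (V2 * V3) => t.1 ⊙ (t.2.1 ⊙ t.2.2)).
Proof. exact: dense_odot (@dense_id V1) (@dense_odot2 V2 V3). Qed.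

Lemma dense_odot4 (V1 V2 V3 V4 : suplattice) :
  dense (fun t : V1 * (V2 * (V3 * V4)) => t.1 ⊙ (t.2.1 ⊙ (t.2.2.1 ⊙ t.2.2.2))).
Proof. exact: dense_odot (@dense_id V1) (@dense_odot3 V2 V3 V4). Qed.

Lemma lat_tensm1 V W :
  lat_tensm (suphom_id V) (suphom_id W) = suphom_id (concept_tensor V W).
Proof. by apply: dense_odot2 => -[x y]; rewrite latE. Qed.

Lemma lat_tensmM V1 W1 X1 V2 W2 X2 (g1 : suphom W1 X1) (f1 : suphom V1 W1)
    (g2 : suphom W2 X2) (f2 : suphom V2 W2) :
  lat_tensm (suphom_cmp g1 f1) (suphom_cmp g2 f2) =
  suphom_cmp (lat_tensm g1 g2) (lat_tensm f1 f2).
Proof. by apply: dense_odot2 => -[x y]; rewrite !latE. Qed.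

Lemma lat_assoc_nat (X Y Z X' Y' Z' : suplattice)
    (f : suphom X X') (g : suphom Y Y') (h : suphom Z Z') :
  suphom_cmp (lat_assoc X' Y' Z') (lat_tensm f (lat_tensm g h)) =
  suphom_cmp (lat_tensm (lat_tensm f g) h) (lat_assoc X Y Z).
Proof. by apply: dense_odot3 => -[x [y z]]; rewrite !latE. Qed.

Lemma lat_lunit_nat (X Y : suplattice) (f : suphom X Y) :
  suphom_cmp (lat_lunit Y) (lat_tensm (suphom_id two) f) =
  suphom_cmp f (lat_lunit X).
Proof.
by apply: (dense_odot dense_true (@dense_id X)) => -[u x]; rewrite !latE.
Qed.

Lemma lat_runit_nat (X Y : suplattice) (f : suphom X Y) :
  suphom_cmp (lat_runit Y) (lat_tensm f (suphom_id two)) =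
  suphom_cmp f (lat_runit X).
Proof.
by apply: (dense_odot (@dense_id X) dense_true) => -[x u]; rewrite !latE.
Qed.

Lemma lat_braid_nat (X Y X' Y' : suplattice) (f : suphom X X') (g : suphom Y Y') :
  suphom_cmp (lat_braid X' Y') (lat_tensm f g) =
  suphom_cmp (lat_tensm g f) (lat_braid X Y).
Proof. by apply: dense_odot2 => -[x y]; rewrite !latE. Qed.

Lemma lat_pentagon (W X Y Z : suplattice) :
  suphom_cmp (lat_assoc (concept_tensor W X) Y Z)
    (lat_assoc W X (concept_tensor Y Z)) =
  suphom_cmp (suphom_cmp (lat_tensm (lat_assoc W X Y) (suphom_id Z))
      (lat_assoc W (concept_tensor X Y) Z))
    (lat_tensm (suphom_id W) (lat_assoc X Y Z)).
Proof. by apply: dense_odot4 => -[w [x [y z]]]; rewrite !latE. Qed.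

Lemma lat_triangle (X Y : suplattice) :
  suphom_cmp (lat_tensm (lat_runit X) (suphom_id Y)) (lat_assoc X two Y) =
  lat_tensm (suphom_id X) (lat_lunit Y).
Proof.
apply: (dense_odot (@dense_id X) (dense_odot dense_true (@dense_id Y))).
by move=> -[x [u y]]; rewrite !latE.
Qed.

Lemma lat_hexagon (X Y Z : suplattice) :
  suphom_cmp (suphom_cmp (lat_assoc Z X Y) (lat_braid (concept_tensor X Y) Z))
    (lat_assoc X Y Z) =
  suphom_cmp (suphom_cmp (lat_tensm (lat_braid X Z) (suphom_id Y))
      (lat_assoc X Z Y))
    (lat_tensm (suphom_id X) (lat_braid Y Z)).
Proof. by apply: dense_odot3 => -[x [y z]]; rewrite !latE. Qed.

Lemma lat_braidK (X Y : suplattice) :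
  suphom_cmp (lat_braid Y X) (lat_braid X Y) = suphom_id (concept_tensor X Y).
Proof. by apply: dense_odot2 => -[x y]; rewrite !latE. Qed.

(** * Invertibility of the structure maps *)

Lemma lat_assoc_iso (X Y Z : SupLat) : is_iso (lat_assoc X Y Z : @hom SupLat _ _).
Proof.
apply: (is_iso_fmap B_functor); apply: (@is_iso_cmp Cxt).
  apply: (@is_iso_cmp Cxt); last exact: cxt_assoc_iso.
  exact: (is_iso_tensm cxt_sym_monoidal (eta_iso (cxt_tens (F_obj X) (F_obj Y)))
    (@is_iso_idm Cxt (F_obj Z))).
exact: (is_iso_tensm cxt_sym_monoidal (@is_iso_idm Cxt (F_obj X))
  (eta_inv_iso (cxt_tens (F_obj Y) (F_obj Z)))).
Qed.

Lemma lat_lunit_iso (X : SupLat) : is_iso (lat_lunit X : @hom SupLat _ _).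
Proof.
apply: (@is_iso_cmp SupLat); first exact: eps_iso.
apply: (is_iso_fmap B_functor); apply: (@is_iso_cmp Cxt); first exact: cxt_lunit_iso.
exact: (is_iso_tensm cxt_sym_monoidal nuF_inv_iso (@is_iso_idm Cxt (F_obj X))).
Qed.

Lemma lat_runit_iso (X : SupLat) : is_iso (lat_runit X : @hom SupLat _ _).
Proof.
apply: (@is_iso_cmp SupLat); first exact: eps_iso.
apply: (is_iso_fmap B_functor); apply: (@is_iso_cmp Cxt); first exact: cxt_runit_iso.
exact: (is_iso_tensm cxt_sym_monoidal (@is_iso_idm Cxt (F_obj X)) nuF_inv_iso).
Qed.

Definition lat_sym_monoidal : @sym_monoidal SupLat concept_tensor two :=
  @SymMonoidal SupLat concept_tensor two (@lat_tensm)
    lat_assoc lat_lunit lat_runit lat_braid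
    lat_tensm1 (@lat_tensmM) lat_assoc_iso (@lat_assoc_nat)
    lat_lunit_iso (@lat_lunit_nat) lat_runit_iso (@lat_runit_nat)
    (@lat_braid_nat) lat_pentagon lat_triangle lat_hexagon lat_braidK.

Lemma lat_is_concept_tensor_structure : is_concept_tensor_structure lat_sym_monoidal.
Proof.
split.
- move=> V1 W1 V2 W2 f g; split; first exact: lat_tensm_odot.
  by move=> h hE; apply: dense_odot2 => -[x y]; rewrite lat_tensm_odot hE.
- exact: lat_assoc_odot.
- by move=> V x; rewrite top_two; exact: lat_lunit_odot.
- by move=> V x; rewrite top_two; exact: lat_runit_odot.
- exact: lat_braid_odot.
Qed.

(** * Discarding *)

(** A supremum is bottom exactly when all its members are. *)
Lemma lat_disc_subproof (V : suplattice) (A : set V) :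
  (`[< sup A <> bot V >] : two) = sup ((fun x : V => `[< x <> bot V >] : two) @` A).
Proof.
apply: (@eq_le_above two) => b; rewrite supP /=.
split=> [h _ [x Ax <-] /asboolP nx|h /asboolP nA].
  apply: h; apply/asboolP => eA; apply: nx; apply: le_bot; rewrite -eA.
  exact: le_sup.
apply: contrapT => nb; apply: nA; apply: le_bot; apply/supP => x Ax.
apply: contrapT => nx; apply: nb; apply: (h `[< x <> bot V >]); first by exists x.
by apply/asboolP => e; apply: nx; rewrite e; exact: le_refl.
Qed.

Definition lat_disc (V : suplattice) : suphom V two :=
  @SupHom V two (fun x => `[< x <> bot V >]) (@lat_disc_subproof V).

Lemma lat_discP (V : suplattice) (x : V) : lat_disc V x = true :> bool <-> x <> bot V.
Proof. by split=> [/asboolP|?] //; apply/asboolP. Qed.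

Lemma lat_disc_unit : lat_disc two = suphom_id two.
Proof.
by apply: dense_true => _; apply: (iffRL (lat_discP (true : two))); rewrite bot_two.
Qed.

(** On [x ⊙ y] both sides ask that neither factor be bottom, by [odot_eq_bot]. *)
Lemma lat_disc_tens (V W : suplattice) :
  lat_disc (concept_tensor V W) =
  suphom_cmp (lat_lunit two) (lat_tensm (lat_disc V) (lat_disc W)).
Proof.
apply: dense_odot2 => -[x y]; rewrite suphom_cmpE lat_tensm_odot.
have [xV|/(iffRL (lat_discP x)) xV] := pselect (x = bot V).
  by rewrite xV odot_botl !suphom_bot odot_botl suphom_bot.
rewrite xV lat_lunit_odot; have [yW|yW] := pselect (y = bot W).
  by rewrite yW odot_botr !suphom_bot.
have -> : lat_disc W y = true by exact/lat_discP.
by apply/lat_discP => /odot_eq_bot []; [exact/lat_discP|].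
Qed.

Definition lat_discarding : discarding lat_sym_monoidal :=
  @Discarding SupLat concept_tensor two lat_sym_monoidal lat_disc
    lat_disc_unit lat_disc_tens.

(** * Inf-preserving maps *)

(** Each attribute of the tensor context cuts out a down-set, and extents are intersections of
    these. *)
Lemma extent_tensor_down (V W : suplattice) (c : concept_tensor V W) x y x' y' :
  le x x' -> le y y' -> extent c (x', y') -> extent c (x, y).
Proof.
move=> xx yy; rewrite -dn_intent => h m /h /= [] e; [left|right].
  exact: le_trans e.
exact: le_trans e.
Qed.

(* If [l] and [k] are left adjoint to [f] and [g] then [f ⊗ g] acts on extents by
   preimage along [l × k], hence commutes with intersections. *)
Lemma extent_lat_tensm V1 W1 V2 W2 (f : suphom V1 W1) (g : suphom V2 W2)
    (l : W1 -> V1) (k : W2 -> V2) c :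
  (forall w v, le (l w) v <-> le w (f v)) ->
  (forall w v, le (k w) v <-> le w (g v)) ->
  extent (lat_tensm f g c) = [set p | extent c (l p.1, k p.2)].
Proof.
move=> lf kg.
have pureT := is_pure_tens (is_pure_pure (@F_map_subproof V1 W1 f))
  (is_pure_pure (@F_map_subproof V2 W2 g)).
have cL : closed ([set p | extent c (l p.1, k p.2)] : set (gob (tensor_context W1 W2))).
  (* By adjunction, this preimage is cut out by the images [(f m.1, g m.2)] of the attributes [m] of
     [c]. *)
  suff -> : [set p | extent c (l p.1, k p.2)] =
      @dn (tensor_context W1 W2) [set q | exists2 m, intent c m & q = (f m.1, g m.2)].
    exact: closed_dn.
  apply/seteqP; split=> -[w z] /=; rewrite -dn_intent.
    by move=> h _ [m /h /= [/lf|/kg] e ->]; [left|right].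
  move=> h m cm; case: (h (f m.1, g m.2)) => /= [|/lf|/kg]; first by exists m.
    by left.
  by right.
apply/seteqP; split.
  apply/(B_map_sub _ _ cL); rewrite pureT // => -[x y] cxy /=.
  (* The counits [l (f x) ≤ x] and [k (g y) ≤ y]. *)
  by apply: extent_tensor_down cxy; [apply/lf|apply/kg]; exact: le_refl.
move=> -[w z] /= clk.
(* The units [w ≤ f (l w)] and [z ≤ g (k z)]. *)
apply: (@extent_tensor_down _ _ (lat_tensm f g c) _ _ (f (l w)) (g (k z)));
  [exact/lf/le_refl|exact/kg/le_refl|].
have := @subset_refl _ (extent (lat_tensm f g c)).
move/(B_map_sub (crel_tens (F_map f) (F_map g)) c (closed_extent _)).
by rewrite pureT; [move=> /(_ _ clk)|exact: closed_extent].
Qed.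

Lemma lat_tensm_inf_preserving V1 W1 V2 W2 (f : suphom V1 W1) (g : suphom V2 W2) :
  inf_preserving f -> inf_preserving g -> inf_preserving (lat_tensm f g).
Proof.
move=> /inf_preservingP[l lf] /inf_preservingP[k kg]; apply/inf_preservingP.
(* The left adjoint is [l ⊗ k], written out on the pure tensors below [d] because [l] and [k] are
   plain functions. *)
exists (fun d : concept_tensor W1 W2 =>
  sup ((fun p => l p.1 ⊙ k p.2) @` extent d)) => d c.
rewrite supP /= /concept_le (extent_lat_tensm c lf kg).
split=> [h p dp|h _ [p dp <-]]; last exact/odot_le/h.
by apply/odot_le/h; exists p.
Qed.

Lemma inf_preserving_wide_subcategory :
  sym_monoidal_wide_subcategory lat_sym_monoidal inf_preserving.
Proof.
split.
- by move=> V A; rewrite image_id.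
- by move=> X Y Z g f hg hf A; rewrite /= hf hg image_comp.
- exact: lat_tensm_inf_preserving.
- by move=> X Y Z; apply: is_iso_inf_preserving; exact: lat_assoc_iso.
- by move=> X; apply: is_iso_inf_preserving; exact: lat_lunit_iso.
- by move=> X; apply: is_iso_inf_preserving; exact: lat_runit_iso.
- move=> X Y; apply: is_iso_inf_preserving.
  by exists (lat_braid Y X); split; exact: lat_braidK.
Qed.

(** * The monoidal equivalence *)

(** [B K ⊗ B L] is [B (F (B K) ⊗ F (B L))] by definition, so it suffices to unwrap both factors by
    [eta_inv]. *)
Definition muB (K L : context) :
    suphom (concept_tensor (concept_lattice K) (concept_lattice L))
           (concept_lattice (cxt_tens K L)) :=
  B_map (crel_tens (eta_inv K) (eta_inv L)).

Lemma muB_gen K L (g : gob K) (h : gob L) :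
  muB K L (gen g ⊙ gen h) = @gen (cxt_tens K L) (g, h).
Proof.
rewrite odotE /muB -(crel_cmp1m (crel_tens _ _)).
apply: (@B_map_cmp_gen (cxt_tens K L)
  (cxt_tens (F_obj (concept_lattice K)) (F_obj (concept_lattice L))) (cxt_tens K L)
  _ _ (crel_tens (eta K) (eta L)) (fun p => (gen p.1, gen p.2)) id (g, h)).
- by rewrite -cxt_tensmM !etaK cxt_tensm1.
- exact: (is_pure_tens (@is_pure_eta K) (@is_pure_eta L)).
- exact: is_pure_id.
Qed.

(** [gen] identifies [two] with [B (F two)], and [nuF_inv] replaces [F two] by the unit context. *)
Definition nuB : suphom two (concept_lattice cxt_unit) :=
  suphom_cmp (B_map nuF_inv) (SupHom (@gen_sup two)).

Lemma nuB_true : nuB true = @gen cxt_unit tt.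
Proof.
rewrite /nuB -(crel_cmp1m nuF_inv).
exact: (@B_map_cmp_gen cxt_unit (F_obj two) cxt_unit (crel_id _) nuF_inv nuF
  (fun _ => true) id tt nuFK is_pure_nuF (@is_pure_id _)).
Qed.

Definition B_mon_data : @mon_data Cxt cxt_tens cxt_unit SupLat concept_tensor two
    B_functor :=
  @MonData Cxt cxt_tens cxt_unit SupLat concept_tensor two B_functor muB nuB.

(** [F (V ⊗ W)] is [F (B (F V ⊗ F W))], so the comparison is an instance of the unit. *)
Definition muF (V W : suplattice) :
    closed_rel (cxt_tens (F_obj V) (F_obj W)) (F_obj (concept_tensor V W)) :=
  eta (cxt_tens (F_obj V) (F_obj W)).

Definition F_mon_data : @mon_data SupLat concept_tensor two Cxt cxt_tens cxt_unit
    F_functor :=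
  @MonData SupLat concept_tensor two Cxt cxt_tens cxt_unit F_functor muF nuF.

(** The image under [B] of the naturality of [eta_inv] in both factors, combined by functoriality of
    the tensor of contexts. *)
Lemma muB_nat K1 L1 K2 L2 (R : closed_rel K1 L1) (S : closed_rel K2 L2) :
  suphom_cmp (muB L1 L2) (lat_tensm (B_map R) (B_map S)) =
  suphom_cmp (B_map (crel_tens R S)) (muB K1 K2).
Proof.
have := B_mapM (crel_tens R S) (crel_tens (eta_inv K1) (eta_inv K2)).
rewrite -cxt_tensmM -!eta_inv_nat cxt_tensmM B_mapM; exact.
Qed.

Lemma muB_iso K L : is_iso (muB K L : @hom SupLat _ _).
Proof.
exact: (is_iso_fmap B_functor
  (is_iso_tensm cxt_sym_monoidal (eta_inv_iso K) (eta_inv_iso L))).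
Qed.

Lemma nuB_iso : is_iso (nuB : @hom SupLat _ _).
Proof.
apply: (@is_iso_cmp SupLat); first exact: (is_iso_fmap B_functor nuF_inv_iso).
exists (eps two); split; first by apply: suphomP; exact: eps_gen.
by apply: (@dense_gen (F_obj two)) => b; exact: (congr1 (@gen (F_obj two)) (eps_gen b)).
Qed.

(** * Coherence of [B], checked on tensors of generators *)

Lemma B_assoc_gen (K1 K2 K3 : context) (x : gob K1) (y : gob K2) (z : gob K3) :
  B_map (cxt_assoc K1 K2 K3) (@gen (cxt_tens K1 (cxt_tens K2 K3)) (x, (y, z))) =
  @gen (cxt_tens (cxt_tens K1 K2) K3) ((x, y), z).
Proof. by rewrite (B_map_gen _ (is_pure_pure (@cxt_assoc_subproof K1 K2 K3))). Qed.

Lemma B_lunit_gen K (x : gob K) :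
  B_map (cxt_lunit K) (@gen (cxt_tens cxt_unit K) (tt, x)) = gen x.
Proof. by rewrite (B_map_gen _ (is_pure_pure (@cxt_lunit_subproof K))). Qed.

Lemma B_runit_gen K (x : gob K) :
  B_map (cxt_runit K) (@gen (cxt_tens K cxt_unit) (x, tt)) = gen x.
Proof. by rewrite (B_map_gen _ (is_pure_pure (@cxt_runit_subproof K))). Qed.

Lemma B_braid_gen K L (x : gob K) (y : gob L) :
  B_map (cxt_braid K L) (@gen (cxt_tens K L) (x, y)) = @gen (cxt_tens L K) (y, x).
Proof. by rewrite (B_map_gen _ (is_pure_pure (@cxt_braid_subproof K L))). Qed.

Definition BE := (latE, muB_gen, nuB_true, B_assoc_gen, B_lunit_gen, B_runit_gen,
  B_braid_gen).

Lemma muB_assoc (X Y Z : context) :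
  suphom_cmp (suphom_cmp (B_map (cxt_assoc X Y Z)) (muB X (cxt_tens Y Z)))
    (lat_tensm (suphom_id (concept_lattice X)) (muB Y Z)) =
  suphom_cmp (suphom_cmp (muB (cxt_tens X Y) Z)
      (lat_tensm (muB X Y) (suphom_id (concept_lattice Z))))
    (lat_assoc (concept_lattice X) (concept_lattice Y) (concept_lattice Z)).
Proof.
apply: (dense_odot (@dense_gen X) (dense_odot (@dense_gen Y) (@dense_gen Z))).
by move=> -[x [y z]]; rewrite !BE.
Qed.

Lemma muB_lunit (X : context) :
  suphom_cmp (suphom_cmp (B_map (cxt_lunit X)) (muB cxt_unit X))
    (lat_tensm nuB (suphom_id (concept_lattice X))) =
  lat_lunit (concept_lattice X).
Proof.
by apply: (dense_odot dense_true (@dense_gen X)) => -[u x]; rewrite !BE.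
Qed.

Lemma muB_runit (X : context) :
  suphom_cmp (suphom_cmp (B_map (cxt_runit X)) (muB X cxt_unit))
    (lat_tensm (suphom_id (concept_lattice X)) nuB) =
  lat_runit (concept_lattice X).
Proof.
by apply: (dense_odot (@dense_gen X) dense_true) => -[x u]; rewrite !BE.
Qed.

Lemma muB_braid (X Y : context) :
  suphom_cmp (B_map (cxt_braid X Y)) (muB X Y) =
  suphom_cmp (muB Y X) (lat_braid (concept_lattice X) (concept_lattice Y)).
Proof.
by apply: (dense_odot (@dense_gen X) (@dense_gen Y)) => -[x y]; rewrite !BE.
Qed.

Lemma B_sym_monoidal_functor :
  is_sym_monoidal_functor cxt_sym_monoidal lat_sym_monoidal B_mon_data.
Proof.
exact: (@IsSymMonoidalFunctor Cxt cxt_tens cxt_unit SupLat concept_tensor two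
  cxt_sym_monoidal lat_sym_monoidal B_functor B_mon_data
  muB_iso (@muB_nat) nuB_iso muB_assoc muB_lunit muB_runit muB_braid).
Qed.

(** * Coherence of [F] *)

Lemma muF_nat V1 W1 V2 W2 (f : suphom V1 W1) (g : suphom V2 W2) :
  crel_cmp (muF W1 W2) (crel_tens (F_map f) (F_map g)) =
  crel_cmp (F_map (lat_tensm f g)) (muF V1 V2).
Proof.
apply: is_pure_eq; [pure|pure|] => -[x y] /=.
by have := lat_tensm_odot f g x y; rewrite !odotE.
Qed.

(** All relations involved are induced by functions, so the law reduces to the value of [lat_assoc]
    on pure tensors. *)
Lemma muF_assoc (X Y Z : suplattice) :
  crel_cmp (crel_cmp (F_map (lat_assoc X Y Z)) (muF X (concept_tensor Y Z)))
    (crel_tens (crel_id (F_obj X)) (muF Y Z)) =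
  crel_cmp (crel_cmp (muF (concept_tensor X Y) Z)
      (crel_tens (muF X Y) (crel_id (F_obj Z))))
    (cxt_assoc (F_obj X) (F_obj Y) (F_obj Z)).
Proof.
apply: is_pure_eq; [pure|pure|] => -[x [y z]].
by have := lat_assoc_odot x y z; rewrite !odotE.
Qed.

Lemma muF_lunit (X : suplattice) :
  crel_cmp (crel_cmp (F_map (lat_lunit X)) (muF two X))
    (crel_tens nuF (crel_id (F_obj X))) = cxt_lunit (F_obj X).
Proof.
apply: is_pure_eq; [pure|pure|] => -[u x].
by have := lat_lunit_odot x; rewrite !odotE.
Qed.

Lemma muF_runit (X : suplattice) :
  crel_cmp (crel_cmp (F_map (lat_runit X)) (muF X two))
    (crel_tens (crel_id (F_obj X)) nuF) = cxt_runit (F_obj X).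
Proof.
apply: is_pure_eq; [pure|pure|] => -[x u].
by have := lat_runit_odot x; rewrite !odotE.
Qed.

Lemma muF_braid (X Y : suplattice) :
  crel_cmp (F_map (lat_braid X Y)) (muF X Y) =
  crel_cmp (muF Y X) (cxt_braid (F_obj X) (F_obj Y)).
Proof.
apply: is_pure_eq; [pure|pure|] => -[x y].
by have := lat_braid_odot x y; rewrite !odotE.
Qed.

Lemma F_sym_monoidal_functor :
  is_sym_monoidal_functor lat_sym_monoidal cxt_sym_monoidal F_mon_data.
Proof.
exact: (@IsSymMonoidalFunctor SupLat concept_tensor two Cxt cxt_tens cxt_unit
  lat_sym_monoidal cxt_sym_monoidal F_functor F_mon_data
  (fun V W => eta_iso (cxt_tens (F_obj V) (F_obj W))) (@muF_nat) nuF_iso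
  muF_assoc muF_lunit muF_runit muF_braid).
Qed.

(** * Monoidality of the unit and the counit *)

Lemma eta_tens (K L : context) :
  crel_cmp (eta (cxt_tens K L)) (crel_id (cxt_tens K L)) =
  crel_cmp (crel_cmp (F_map (muB K L)) (muF (concept_lattice K) (concept_lattice L)))
    (crel_tens (eta K) (eta L)).
Proof.
apply: is_pure_eq; [pure|pure|] => -[x y].
by have := muB_gen x y; rewrite odotE.
Qed.

Lemma eta_unit :
  crel_cmp (eta cxt_unit) (crel_id cxt_unit) = crel_cmp (F_map nuB) nuF.
Proof. by apply: is_pure_eq; [pure|pure|] => -[]; have := nuB_true. Qed.

Lemma eps_tens (V W : suplattice) :
  suphom_cmp (eps (concept_tensor V W))
    (suphom_cmp (B_map (muF V W)) (muB (F_obj V) (F_obj W))) =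
  suphom_cmp (suphom_id (concept_tensor V W)) (lat_tensm (eps V) (eps W)).
Proof.
apply: (dense_odot (@dense_gen (F_obj V)) (@dense_gen (F_obj W))) => -[x y].
rewrite !suphom_cmpE lat_tensm_odot !eps_gen muB_gen suphom_idE odotE.
rewrite (B_map_gen _ (@is_pure_eta (cxt_tens (F_obj V) (F_obj W)))).
exact: eps_gen.
Qed.

Lemma eps_unit :
  suphom_cmp (eps two) (suphom_cmp (B_map nuF) nuB) = suphom_id two.
Proof.
apply: dense_true => u; rewrite 2!suphom_cmpE nuB_true.
by rewrite (B_map_gen _ is_pure_nuF); exact: eps_gen.
Qed.

Lemma B_F_sym_monoidal_equivalence :
  is_sym_monoidal_equivalence cxt_sym_monoidal lat_sym_monoidal
    B_mon_data F_mon_data.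
Proof.
split.
- exact: B_sym_monoidal_functor.
- exact: F_sym_monoidal_functor.
- exists eta; split; [split; [exact: eta_iso|exact: eta_nat]|exact: eta_tens|].
  exact: eta_unit.
- exists eps; split; [split; [exact: eps_iso|exact: eps_nat]|exact: eps_tens|].
  by rewrite /= -[RHS]eps_unit.
Qed.

(** * Preservation of discarding *)

Lemma gen_eq_bot (K : context) (g : gob K) :
  gen g = bot (concept_lattice K) <-> dn setT g.
Proof.
have -> : gen g = bot (concept_lattice K) <-> le (gen g) (bot (concept_lattice K)).
  by split=> [->|/le_bot] //; exact: le_refl.
rewrite gen_le; split=> h m _; apply: h => //.
by move=> x [c []].
Qed.

(** [cxt_disc] need not be induced by a function, as it can take an empty value: if [gen g] is
    bottom both sides are bottom, otherwise extents are compared. *)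
Lemma B_preserves_discarding :
  preserves_discarding B_mon_data cxt_discarding lat_discarding.
Proof.
move=> K; apply: (@dense_gen K) => g.
change (B_map (cxt_disc K) (gen g) = nuB (lat_disc _ (gen g))).
have [b|nb] := pselect (dn setT g).
  by rewrite (iffRL (gen_eq_bot g) b) !suphom_bot.
have -> : lat_disc _ (gen g) = true by apply/lat_discP; rewrite gen_eq_bot.
rewrite nuB_true; apply: conceptP; rewrite extent_B_map_gen.
apply/seteqP; split=> -[] _; first exact: (@sub_closure cxt_unit [set tt]).
rewrite /= /cxt_disc_fun /= => e; apply: nb => m _.
by have /(_ g erefl) : up [set g] m by rewrite e.
Qed.

(** Both sides pull a closed [Z] back to the [x] with [Z true] or [x = bot V]; the second case rests
    on [closed_two]. *)
Lemma F_preserves_discarding :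
  preserves_discarding F_mon_data lat_discarding cxt_discarding.
Proof.
move=> V; apply: eq_crel => Z cZ.
rewrite bullet_pure // [RHS]bullet_cmp // bullet_pure // bullet_disc.
have Z0 := closed_two cZ.
have dnE (x : V) : @dn (F_obj V) setT x <-> x = bot V.
  split=> [h|-> m _]; last exact: bot_le.
  by apply: le_bot; apply: h.
have ZE x : Z (lat_disc V x) <-> Z true \/ x = bot V.
  have [->|nx] := pselect (x = bot V); first by rewrite suphom_bot bot_two; tauto.
  by rewrite (iffRL (lat_discP x) nx); tauto.
apply/seteqP; split=> x.
  by move=> /ZE [h|/dnE h]; [left|right].
by move=> [h|/dnE h]; apply/ZE; [left|right].
Qed.

Theorem theorem33 :
  exists (S : @sym_monoidal SupLat concept_tensor two) (d : discarding S),
    [/\ is_concept_tensor_structure S,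
        is_suplat_discarding d,
        sym_monoidal_wide_subcategory S inf_preserving &
        exists (MB : @mon_data Cxt cxt_tens cxt_unit SupLat concept_tensor two
                       B_functor)
               (MF : @mon_data SupLat concept_tensor two Cxt cxt_tens cxt_unit
                       F_functor),
          [/\ is_sym_monoidal_equivalence cxt_sym_monoidal S MB MF,
              preserves_discarding MB cxt_discarding d &
              preserves_discarding MF d cxt_discarding]].
Proof.
exists lat_sym_monoidal, lat_discarding; split.
- exact: lat_is_concept_tensor_structure.
- by move=> V x; rewrite top_two; exact: lat_discP.
- exact: inf_preserving_wide_subcategory.
exists B_mon_data, F_mon_data; split.
- exact: B_F_sym_monoidal_equivalence.
- exact: B_preserves_discarding.
- exact: F_preserves_discarding.
Qed.
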